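(* Let $\bar x\in M$ be a nondegenerate C-stationary point of MPCC with quadratic and biactive indices $\text{MPCC-}QI$ and $\text{MPCC-}BI$, respectively. Assume that MPCC-ND4 holds at $\bar x$. Then, for all sufficiently small $t>0$ there exists a nondegenerate C-stationary point $x^t\in M^{\text{D}(t)}$ of $\text{D}(t)$ within a neighborhood of $\bar x$, which has the same respective quadratic and biactive indices $$\text{DISJ-}QI=\text{MPCC-}QI,\qquad \text{DISJ-}BI=\text{MPCC-}BI.$$ Thus, for its C-index, $\text{DISJ-}CI=\text{MPCC-}CI$. Moreover, for any fixed $t$ sufficiently small, such $x^t$ is the unique C-stationary point of $\text{D}(t)$ in a sufficiently small neighborhood of $\bar x$.
   Context: Let $f\in C^2(\mathbb{R}^n,\mathbb{R})$, $F_1,F_2\in C^2(\mathbb{R}^n,\mathbb{R}^\kappa)$. MPCC is the problem $\min f(x)$ s.t. $x\in M$ with $M=\{x\in\mathbb{R}^n \mid F_{1,j}(x)\cdot F_{2,j}(x)=0,\ F_{1,j}(x)\ge 0,\ F_{2,j}(x)\ge 0,\ j=1,\ldots,\kappa\}$. For $t>0$, the disjunctive regularization $\text{D}(t)$ is the problem $\min f(x)$ s.t. $x\in M^{\text{D}(t)}$ with $M^{\text{D}(t)}=\{x\in\mathbb{R}^n \mid \max\{t-F_{1,j}(x),t-F_{2,j}(x)\}\ge 0,\ F_{1,j}(x)\ge 0,\ F_{2,j}(x)\ge 0,\ j=1,\ldots,\kappa\}$. MPCC notions. For $\bar x\in M$: $a_{01}(\bar x)=\{j\mid F_{1,j}(\bar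 x)=0,F_{2,j}(\bar x)>0\}$, $a_{10}(\bar x)=\{j\mid F_{1,j}(\bar x)>0,F_{2,j}(\bar x)=0\}$, $a_{00}(\bar x)=\{j\mid F_{1,j}(\bar x)=F_{2,j}(\bar x)=0\}$. MPCC-LICQ at $\bar x$: the vectors $\nabla F_{1,j}(\bar x)$, $j\in a_{01}(\bar x)\cup a_{00}(\bar x)$, and $\nabla F_{2,j}(\bar x)$, $j\in a_{10}(\bar x)\cup a_{00}(\bar x)$, are linearly independent. $\bar x\in M$ is C-stationary for MPCC if there exist multipliers $\bar\sigma_{1,j}$ ($j\in a_{01}(\bar x)$), $\bar\sigma_{2,j}$ ($j\in a_{10}(\bar x)$), $\bar\varrho_{1,j},\bar\varrho_{2,j}$ ($j\in a_{00}(\bar x)$) with $\nabla L(\bar x)=0$ and $\bar\varrho_{1,j}\cdot\bar\varrho_{2,j}\ge 0$ for all $j\in a_{00}(\bar x)$, where $$L(x)=f(x)-\sum_{j\in a_{01}(\bar x)}\bar\sigma_{1,j}F_{1,j}(x)-\sum_{j\in a_{10}(\bar x)}\bar\sigma_{2,j}F_{2,j}(x)-\sum_{j\in a_{00}(\bar x)}\left(\bar\varrho_{1,j}F_{1,j}(x)+\bar\varrho_{2,j}F_{2,j}(x)\right).$$ Tangent space: $\mathcal{T}_{\bar x}=\{\xi\in\mathbb{R}^n\mid\nabla^TF_{1,j}(\bar x)\xi=0,\ j\in a_{01}(\bar x)\cup a_{00}(\bar x);\ \nabla^TF_{2,j}(\bar x)\xi=0,\ j\in a_{10}(\bar x)\cup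 a_{00}(\bar x)\}$. A C-stationary point $\bar x$ is nondegenerate if: MPCC-ND1: MPCC-LICQ holds at $\bar x$ (so the multipliers are unique); MPCC-ND2: $\bar\varrho_{1,j}\cdot\bar\varrho_{2,j}>0$ for all $j\in a_{00}(\bar x)$; MPCC-ND3: the restricted Hessian $D^2L(\bar x)\restriction_{\mathcal{T}_{\bar x}}$ is nonsingular (as a quadratic form on $\mathcal{T}_{\bar x}$). Condition MPCC-ND4: $\bar\sigma_{1,j}\neq 0$ for all $j\in a_{01}(\bar x)$ and $\bar\sigma_{2,j}\ne 0$ for all $j\in a_{10}(\bar x)$. For a nondegenerate C-stationary point: $\text{MPCC-}QI$ is the number of negative eigenvalues of $D^2L(\bar x)\restriction_{\mathcal{T}_{\bar x}}$; $\text{MPCC-}BI$ is the number of $j\in a_{00}(\bar x)$ with $\bar\varrho_{1,j},\bar\varrho_{2,j}<0$; $\text{MPCC-}CI=\text{MPCC-}QI+\text{MPCC-}BI$. $\text{D}(t)$ notions. For $x\in M^{\text{D}(t)}$: $\mathcal{H}_{12}(x)=\{j\mid F_{1,j}(x)=F_{2,j}(x)=t\}$, $\mathcal{H}_{1}(x)=\{j\mid F_{1,j}(x)=t,F_{2,j}(x)>t\}$, $\mathcal{H}_{2}(x)=\{j\mid F_{1,j}(x)>t,F_{2,j}(x)=t\}$, $\mathcal{N}_1(x)=\{j\mid F_{1,j}(x)=0\}$, $\mathcal{N}_2(x)=\{j\mid F_{2,j}(x)=0\}$. DISJ-LICQ at $x$: the vectors $\nabla F_{1,j}(x)$, $j\in\mathcal{H}_{12}(x)\cup\mathcal{H}_1(x)\cup\mathcal{N}_1(x)$,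 and $\nabla F_{2,j}(x)$, $j\in\mathcal{H}_{12}(x)\cup\mathcal{H}_2(x)\cup\mathcal{N}_2(x)$, are linearly independent. $x\in M^{\text{D}(t)}$ is C-stationary for $\text{D}(t)$ if there exist multipliers $\zeta_{1,j},\zeta_{2,j}\ge 0$ ($j\in\mathcal{H}_{12}(x)$), $\eta_{1,j}\ge 0$ ($j\in\mathcal{H}_1(x)$), $\eta_{2,j}\ge 0$ ($j\in\mathcal{H}_2(x)$), $\nu_{1,j}\ge 0$ ($j\in\mathcal{N}_1(x)$), $\nu_{2,j}\ge 0$ ($j\in\mathcal{N}_2(x)$) such that the gradient at $y=x$ of the Lagrange function (index sets and multipliers fixed at $x$) $$L^{\text{D}(t)}(y)=f(y)-\sum_{j\in\mathcal{H}_{12}(x)}\left(\zeta_{1,j}(t-F_{1,j}(y))+\zeta_{2,j}(t-F_{2,j}(y))\right)-\sum_{j\in\mathcal{H}_1(x)}\eta_{1,j}(t-F_{1,j}(y))-\sum_{j\in\mathcal{H}_2(x)}\eta_{2,j}(t-F_{2,j}(y))-\sum_{j\in\mathcal{N}_1(x)}\nu_{1,j}F_{1,j}(y)-\sum_{j\in\mathcal{N}_2(x)}\nu_{2,j}F_{2,j}(y)$$ vanishes. Tangent space: $\mathcal{T}^{\text{D}(t)}_{x}=\{\xi\in\mathbb{R}^n\mid\nabla^TF_{1,j}(x)\xi=0,\ j\in\mathcal{H}_{12}(x)\cup\mathcal{H}_1(x)\cup\mathcal{N}_1(x);\ \nabla^TF_{2,j}(x)\xi=0,\ j\in\mathcal{H}_{12}(x)\cup\mathcal{H}_2(x)\cup\mathcal{N}_2(x)\}$.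 A C-stationary point $x$ of $\text{D}(t)$ is nondegenerate if: DISJ-ND1: DISJ-LICQ holds at $x$; DISJ-ND2: all the multipliers $\zeta_{1,j},\zeta_{2,j}$ ($j\in\mathcal{H}_{12}(x)$), $\eta_{1,j}$ ($j\in\mathcal{H}_1(x)$), $\eta_{2,j}$ ($j\in\mathcal{H}_2(x)$), $\nu_{1,j}$ ($j\in\mathcal{N}_1(x)$), $\nu_{2,j}$ ($j\in\mathcal{N}_2(x)$) are $>0$; DISJ-ND3: $D^2L^{\text{D}(t)}(x)\restriction_{\mathcal{T}^{\text{D}(t)}_{x}}$ is nonsingular. For a nondegenerate C-stationary point of $\text{D}(t)$: $\text{DISJ-}QI$ is the number of negative eigenvalues of $D^2L^{\text{D}(t)}(x)\restriction_{\mathcal{T}^{\text{D}(t)}_{x}}$; $\text{DISJ-}BI$ is the number of $j\in\mathcal{H}_{12}(x)$ with $\zeta_{1,j}\ne 0,\zeta_{2,j}\neq 0$; $\text{DISJ-}CI=\text{DISJ-}QI+\text{DISJ-}BI$. *)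

(* Defs.v *)
From HB Require Import structures.
From mathcomp Require Import all_boot all_order all_algebra.
From mathcomp Require Import all_classical all_reals all_analysis.
From mathcomp Require polyrcf.

Set Implicit Arguments.
Unset Strict Implicit.
Unset Printing Implicit Defensive.

Import Order.TTheory GRing.Theory Num.Theory.
Import numFieldNormedType.Exports.

Local Open Scope ring_scope.

(* Points, gradients and tangent vectors of R^n are row vectors. *)

Section smooth_functions.
Context {R : realType} {n : nat}.
Implicit Type g : 'rV[R]_n -> R.

Definition partial g (i : 'I_n) (x : 'rV[R]_n) : R := 'D_(delta_mx 0 i) g x.

Definition grad g (x : 'rV[R]_n) : 'rV[R]_n := \row_i partial g i x.

Definition hess g (x : 'rV[R]_n) : 'M[R]_n :=
  \matrix_(i, j) partial (partial g j) i x.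

Definition C1 g : Prop :=
  (forall x, differentiable g x) /\ forall i, continuous (partial g i).

Definition C2 g : Prop := C1 g /\ forall i, C1 (partial g i).

End smooth_functions.

Definition coord_fun {R : realType} {n k : nat} (F : 'rV[R]_n -> 'rV[R]_k)
  (j : 'I_k) (x : 'rV[R]_n) : R := F x 0 j.

Definition vC2 {R : realType} {n k : nat} (F : 'rV[R]_n -> 'rV[R]_k) : Prop :=
  forall j, C2 (coord_fun F j).

(* Eigenvalues are counted with algebraic multiplicity. *)
Definition num_neg_eigenvalues {R : realType} {m : nat} (A : 'M[R]_m) : nat :=
  (\sum_(a <- polyrcf.rootsR (char_poly A) | (a < 0)%R) mup a (char_poly A))%N.

(* For a symmetric H and B a basis of the row space of T, this is the matrix, *)
(* in the basis B and acting on row vectors, of the self-adjoint operator     *)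
(* xi |-> (orthogonal projection on T of H xi) of T, i.e., of the operator of *)
(* the quadratic form of H restricted to T.  A change of basis yields a       *)
(* similar matrix, so that invertibility and eigenvalues only depend on T; if *)
(* B is orthonormal this is B H B^T.                                          *)
Definition restrict_form {R : realType} {n : nat} (H T : 'M[R]_n) :
    'M[R]_(\rank T) :=
  let B := row_base T in B *m H *m B^T *m invmx (B *m B^T).

Section active_gradients.
Context {R : realType} {n k : nat}.
Variables (F1 F2 : 'rV[R]_n -> 'rV[R]_k) (A1 A2 : {set 'I_k}) (x : 'rV[R]_n).

Definition licq : bool :=
  free ([seq grad (coord_fun F1 j) x | j <- enum A1] ++
        [seq grad (coord_fun F2 j) x | j <- enum A2]).

(* The row space is the set of all xi orthogonal to the listed gradients. *)
Definition tangent : 'M[R]_n :=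
  ((\bigcap_(j in A1) kermx (grad (coord_fun F1 j) x)^T) :&:
   (\bigcap_(j in A2) kermx (grad (coord_fun F2 j) x)^T))%MS.

End active_gradients.

(* Multipliers are total functions of the index j; only their values on the   *)
(* relevant index sets at the given point are ever used.                      *)
Record mpcc_mult (R : realType) (k : nat) := MpccMult {
  sigma1 : 'I_k -> R; sigma2 : 'I_k -> R;
  rho1 : 'I_k -> R; rho2 : 'I_k -> R }.

Record disj_mult (R : realType) (k : nat) := DisjMult {
  zeta1 : 'I_k -> R; zeta2 : 'I_k -> R;
  eta1 : 'I_k -> R; eta2 : 'I_k -> R;
  nu1 : 'I_k -> R; nu2 : 'I_k -> R }.

Section MPCC.
Context {R : realType} {n k : nat}.
Variables (f : 'rV[R]_n -> R) (F1 F2 : 'rV[R]_n -> 'rV[R]_k).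
Implicit Types (x y : 'rV[R]_n) (m : mpcc_mult R k).

Definition mpcc_feasible x : Prop := forall j,
  [/\ F1 x 0 j * F2 x 0 j = 0, 0 <= F1 x 0 j & 0 <= F2 x 0 j].

Definition a01 x : {set 'I_k} :=
  [set j | (F1 x 0 j == 0) && (0 < F2 x 0 j)]%SET.
Definition a10 x : {set 'I_k} :=
  [set j | (0 < F1 x 0 j) && (F2 x 0 j == 0)]%SET.
Definition a00 x : {set 'I_k} :=
  [set j | (F1 x 0 j == 0) && (F2 x 0 j == 0)]%SET.

Definition mpcc_licq x : bool :=
  licq F1 F2 (a01 x :|: a00 x)%SET (a10 x :|: a00 x)%SET x.

Definition mpcc_tangent x : 'M[R]_n :=
  tangent F1 F2 (a01 x :|: a00 x)%SET (a10 x :|: a00 x)%SET x.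

(* Lagrange function with index sets and multipliers fixed at x. *)
Definition mpcc_lagrangian x m : 'rV[R]_n -> R := fun y =>
  f y - \sum_(j in a01 x) sigma1 m j * F1 y 0 j
      - \sum_(j in a10 x) sigma2 m j * F2 y 0 j
      - \sum_(j in a00 x) (rho1 m j * F1 y 0 j + rho2 m j * F2 y 0 j).

Definition mpcc_C_stationary_with x m : Prop :=
  [/\ mpcc_feasible x, grad (mpcc_lagrangian x m) x = 0
    & forall j, j \in a00 x -> 0 <= rho1 m j * rho2 m j].

Definition mpcc_restricted_hess x m :=
  restrict_form (hess (mpcc_lagrangian x m) x) (mpcc_tangent x).

Definition mpcc_ND2 x m : Prop :=
  forall j, j \in a00 x -> 0 < rho1 m j * rho2 m j.

Definition mpcc_ND3 x m : Prop := mpcc_restricted_hess x m \in unitmx.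

Definition mpcc_ND4 x m : Prop :=
  (forall j, j \in a01 x -> sigma1 m j != 0) /\
  (forall j, j \in a10 x -> sigma2 m j != 0).

(* By LICQ the multipliers m of a nondegenerate point x are unique on the     *)
(* index sets, so the indices below only depend on x.                         *)
Definition mpcc_nondegenerate_with x m : Prop :=
  [/\ mpcc_C_stationary_with x m, mpcc_licq x, mpcc_ND2 x m & mpcc_ND3 x m].

Definition mpcc_QI x m : nat := num_neg_eigenvalues (mpcc_restricted_hess x m).

Definition mpcc_BI x m : nat :=
  #|[set j in a00 x | (rho1 m j < 0) && (rho2 m j < 0)]%SET|.

Definition mpcc_CI x m : nat := (mpcc_QI x m + mpcc_BI x m)%N.

End MPCC.

Section DISJ.
Context {R : realType} {n k : nat}.
Variables (f : 'rV[R]_n -> R) (F1 F2 : 'rV[R]_n -> 'rV[R]_k) (t : R).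
Implicit Types (x y : 'rV[R]_n) (m : disj_mult R k).

Definition disj_feasible x : Prop := forall j,
  [/\ 0 <= Num.max (t - F1 x 0 j) (t - F2 x 0 j),
      0 <= F1 x 0 j & 0 <= F2 x 0 j].

Definition H12 x : {set 'I_k} :=
  [set j | (F1 x 0 j == t) && (F2 x 0 j == t)]%SET.
Definition H1 x : {set 'I_k} :=
  [set j | (F1 x 0 j == t) && (t < F2 x 0 j)]%SET.
Definition H2 x : {set 'I_k} :=
  [set j | (t < F1 x 0 j) && (F2 x 0 j == t)]%SET.
Definition N1 x : {set 'I_k} := [set j | F1 x 0 j == 0]%SET.
Definition N2 x : {set 'I_k} := [set j | F2 x 0 j == 0]%SET.

Definition disj_licq x : bool :=
  licq F1 F2 (H12 x :|: H1 x :|: N1 x)%SET (H12 x :|: H2 x :|: N2 x)%SET x.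

Definition disj_tangent x : 'M[R]_n :=
  tangent F1 F2 (H12 x :|: H1 x :|: N1 x)%SET (H12 x :|: H2 x :|: N2 x)%SET x.

(* Lagrange function with index sets and multipliers fixed at x. *)
Definition disj_lagrangian x m : 'rV[R]_n -> R := fun y =>
  f y - \sum_(j in H12 x)
          (zeta1 m j * (t - F1 y 0 j) + zeta2 m j * (t - F2 y 0 j))
      - \sum_(j in H1 x) eta1 m j * (t - F1 y 0 j)
      - \sum_(j in H2 x) eta2 m j * (t - F2 y 0 j)
      - \sum_(j in N1 x) nu1 m j * F1 y 0 j
      - \sum_(j in N2 x) nu2 m j * F2 y 0 j.

Definition disj_C_stationary_with x m : Prop :=
  [/\ disj_feasible x,
      grad (disj_lagrangian x m) x = 0,
      forall j, j \in H12 x -> 0 <= zeta1 m j /\ 0 <= zeta2 m j,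
      (forall j, j \in H1 x -> 0 <= eta1 m j) /\
      (forall j, j \in H2 x -> 0 <= eta2 m j)
    & (forall j, j \in N1 x -> 0 <= nu1 m j) /\
      (forall j, j \in N2 x -> 0 <= nu2 m j)].

Definition disj_C_stationary x : Prop := exists m, disj_C_stationary_with x m.

Definition disj_restricted_hess x m :=
  restrict_form (hess (disj_lagrangian x m) x) (disj_tangent x).

Definition disj_ND2 x m : Prop :=
  [/\ forall j, j \in H12 x -> 0 < zeta1 m j /\ 0 < zeta2 m j,
      forall j, j \in H1 x -> 0 < eta1 m j,
      forall j, j \in H2 x -> 0 < eta2 m j,
      forall j, j \in N1 x -> 0 < nu1 m j
    & forall j, j \in N2 x -> 0 < nu2 m j].

Definition disj_ND3 x m : Prop := disj_restricted_hess x m \in unitmx.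

Definition disj_nondegenerate_with x m : Prop :=
  [/\ disj_C_stationary_with x m, disj_licq x, disj_ND2 x m & disj_ND3 x m].

Definition disj_QI x m : nat := num_neg_eigenvalues (disj_restricted_hess x m).

Definition disj_BI x m : nat :=
  #|[set j in H12 x | (zeta1 m j != 0) && (zeta2 m j != 0)]%SET|.

Definition disj_CI x m : nat := (disj_QI x m + disj_BI x m)%N.

End DISJ.

(* Main.v *)
(* By MPCC-ND4 and MPCC-ND2 every active constraint of xbar has a nonzero      *)
(* multiplier.  At a C-stationary point of D(t) near xbar, LICQ makes the      *)
(* signed multipliers (nu for an active bound F = 0, - zeta or - eta for       *)
(* F = t) close to those of xbar, and their signs then decide which of the     *)
(* bounds 0 and t is attained: F = t if the multiplier is negative, F = 0 if   *)
(* it is positive.  So these points solve the equality constrained KKT system  *)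
(*   grad f x = sum_j l_j grad G_j x,   G_j x = t s_j,                         *)
(* with s_j = 1 if the multiplier of G_j at xbar is negative and s_j = 0       *)
(* otherwise.  The derivative of the system at xbar is nonsingular, so it has  *)
(* exactly one solution near xbar for small t, obtained from Banach's fixed    *)
(* point theorem.  The active gradients and the Hessian of the Lagrangian      *)
(* depend continuously on the solution, and the number of negative             *)
(* eigenvalues of a nondegenerate symmetric form is locally constant.          *)

From HB Require Import structures.
Require Import Defs.
From mathcomp Require Import all_boot all_order all_algebra.
From mathcomp Require Import all_classical all_reals all_analysis.
From mathcomp Require Import zify ring lra.
From mathcomp Require polyrcf.
Import Order.TTheory GRing.Theory Num.Theory.
Import numFieldNormedType.Exports.
Local Open Scope classical_set_scope.
Local Open Scope ring_scope.

Set Implicit Arguments.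
Unset Strict Implicit.
Unset Printing Implicit Defensive.

(** * Quadratic forms and their negative index *)

(** Near xbar the disjunctive problem D(t) reduces to a smooth equality constrained one. The
    components of F1 and F2 that vanish at xbar are stacked into one family G ([joined]), each with
    one signed multiplier. ND2 and ND4 make every signed multiplier of xbar nonzero ([mult_neq0]),
    and ND2 gives the two multipliers of a biactive index the same sign ([mult_a00]). In D(t) a
    positive signed multiplier can only come from the bound F = 0 and a negative one only from F =
    t. Hence the active bounds of a C-stationary point near xbar are known in advance. A biactive
    index lands in [H12] exactly when both its multipliers are negative, which gives equality of the
    biactive indices ([shifted_BI]).

    The derivative of the resulting KKT system at xbar is invertible by LICQ and ND3
    ([kkt_mx_unit]), so [strict_diff_local_inverse] yields, for a small right-hand side, one
    solution close to xbar ([kkt_path]). Every C-stationary point of D(t) near xbar solves this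
    system ([disj_active], with [near_multipliers]), which gives uniqueness. Conversely its solution
    carries multipliers of the right signs ([shifted_C_stationary], [shifted_ND2]), which gives
    existence.

    For the quadratic index, a basis of the tangent space at xbar is projected to the tangent spaces
    of nearby points ([moved_basis]), so that forms of one fixed size are compared ([near_index]).
    Their number of negative eigenvalues is locally constant ([num_neg_stable]), by simultaneous
    diagonalization ([gen_spectral]) and a dimension count ([neg_dim]). *)

Section cvg_bigops.
Context {R : realType} {T I : Type} {F : set_system T} {FF : Filter F}.

Lemma cvg_sumr (r : seq I) (P : pred I) (f : I -> T -> R) (a : I -> R) :
    (forall i, P i -> f i x @[x --> F] --> a i) ->
  \sum_(i <- r | P i) f i x @[x --> F] --> \sum_(i <- r | P i) a i.
Proof. by apply: cvg_big; exact: add_continuous. Qed.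

Lemma cvg_prodr (r : seq I) (P : pred I) (f : I -> T -> R) (a : I -> R) :
    (forall i, P i -> f i x @[x --> F] --> a i) ->
  \prod_(i <- r | P i) f i x @[x --> F] --> \prod_(i <- r | P i) a i.
Proof. by apply: cvg_big; exact: mul_continuous. Qed.

End cvg_bigops.

Section entries.
Context {R : realType} {m n : nat}.
Implicit Types A B : 'M[R]_(m, n).

Lemma addmxE A B i j : (A + B) i j = A i j + B i j. Proof. by rewrite mxE. Qed.

Lemma oppmxE A i j : (- A) i j = - A i j. Proof. by rewrite mxE. Qed.

Lemma scalemxE a A i j : (a *: A) i j = a * A i j. Proof. by rewrite mxE. Qed.

End entries.

(** * Simultaneous diagonalization of a symmetric form and a positive definite one *)

Section quadratic_forms.
Context {R : realType}.
Implicit Types (r q n : nat).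

Definition qform r (S : 'M[R]_r) (v : 'rV[R]_r) : R := (v *m S *m v^T) 0 0.

Definition posdef r (S : 'M[R]_r) := forall v, v != 0 -> 0 < qform S v.

Lemma qformE r (S : 'M[R]_r) v :
  qform S v = \sum_i \sum_j v 0 i * S i j * v 0 j.
Proof.
rewrite /qform mxE exchange_big; apply: eq_bigr => j _.
by rewrite !mxE mulr_suml; apply: eq_bigr => i _.
Qed.

Lemma qformD r (S T : 'M[R]_r) v : qform (S + T) v = qform S v + qform T v.
Proof. by rewrite /qform mulmxDr mulmxDl mxE. Qed.

Lemma qformZ r a (S : 'M[R]_r) v : qform (a *: S) v = a * qform S v.
Proof. by rewrite /qform -scalemxAr -scalemxAl mxE. Qed.

Lemma qformN r (S : 'M[R]_r) v : qform (- S) v = - qform S v.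
Proof. by rewrite -scaleN1r qformZ mulN1r. Qed.

Lemma qform_scale r (S : 'M[R]_r) a v : qform S (a *: v) = a ^+ 2 * qform S v.
Proof.
by rewrite /qform linearZ /= -!scalemxAl -scalemxAr scalerA mxE expr2.
Qed.

Lemma qform_congr r q (P : 'M[R]_(q, r)) (S : 'M[R]_r) v :
  qform (P *m S *m P^T) v = qform S (v *m P).
Proof. by rewrite /qform trmx_mul !mulmxA. Qed.

Lemma qform_add r (S : 'M[R]_r) u v : S^T = S ->
  qform S (u + v) = qform S u + (u *m S *m v^T) 0 0 *+ 2 + qform S v.
Proof.
move=> symS; rewrite /qform linearD /= !(mulmxDl, mulmxDr) !addmxE.
have -> : (v *m S *m u^T) 0 0 = (u *m S *m v^T) 0 0.
  by rewrite -[in LHS]symS -[v in LHS]trmxK -!trmx_mul mxE mulmxA.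
by ring.
Qed.

Lemma sqr_norm_row r (v : 'rV[R]_r) : (v *m v^T) 0 0 = \sum_i v 0 i ^+ 2.
Proof. by rewrite mxE; apply: eq_bigr => i _; rewrite !mxE expr2. Qed.

Lemma sqr_norm_row_eq0 r (v : 'rV[R]_r) : (v *m v^T) 0 0 = 0 -> v = 0.
Proof.
rewrite sqr_norm_row => /eqP; rewrite psumr_eq0; last by move=> *; exact: sqr_ge0.
move=> /allP v0; apply/rowP => i; rewrite mxE.
by apply/eqP; rewrite -sqrf_eq0; apply: v0; rewrite mem_index_enum.
Qed.

Lemma sqr_norm_row_ge0 r (v : 'rV[R]_r) : 0 <= (v *m v^T) 0 0.
Proof. by rewrite sqr_norm_row sumr_ge0 // => *; exact: sqr_ge0. Qed.

Lemma posdef1 r : posdef (1%:M : 'M[R]_r).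
Proof.
move=> v vN0; rewrite /qform mulmx1 lt_def sqr_norm_row_ge0 andbT.
by apply: contra_neq vN0 => /sqr_norm_row_eq0.
Qed.

Lemma posdef_congr r q (P : 'M[R]_(q, r)) (S : 'M[R]_r) :
  row_free P -> posdef S -> posdef (P *m S *m P^T).
Proof.
move=> freeP pS v vN0; rewrite qform_congr pS //.
apply: contra_neq vN0 => vP0; apply: (row_free_inj freeP).
by rewrite vP0 mul0mx.
Qed.

Lemma posdef_gram r n (B : 'M[R]_(r, n)) : row_free B -> posdef (B *m B^T).
Proof.
by move=> fB; rewrite -[B in B *m _]mulmx1; exact: posdef_congr (@posdef1 _).
Qed.

Lemma posdef_unit r (S : 'M[R]_r) : posdef S -> S \in unitmx.
Proof.
move=> pS; rewrite -row_free_unit -kermx_eq0; apply/rowV0P => v.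
move=> /sub_kermxP vS; apply/eqP/negP => /negP /pS.
by rewrite /qform vS mul0mx mxE ltxx.
Qed.

(* The first-order optimality condition of a minimizer of the form. *)
Lemma qform_null r (N : 'M[R]_r) v : N^T = N -> (forall w, 0 <= qform N w) ->
  qform N v = 0 -> v *m N = 0.
Proof.
move=> symN posN v0; apply: sqr_norm_row_eq0; set u := v *m N.
set a := (u *m u^T) 0 0; set b := qform N u.
have a0 : 0 <= a := sqr_norm_row_ge0 _.
have b0 : 0 <= b := posN u.
have b1 : b + 1 != 0 by rewrite gt_eqF // ltr_wpDl.
(* With s = a / (b + 1), the form at v - s u equals - s^2 (b + 2), so nonnegativity forces s = 0 and
   hence a = 0. The + 1 keeps the denominator nonzero. *)
have := posN (v + (- (a / (b + 1))) *: u).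
rewrite qform_add // v0 add0r qform_scale linearZ /= -scalemxAr mxE -/u -/a -/b.
set s := a / (b + 1); have ea : a = s * (b + 1) by rewrite /s divfK.
rewrite ea; have s0 : 0 <= s by rewrite /s divr_ge0 // addr_ge0.
nra.
Qed.

Lemma continuous_qform r (S : 'M[R]_r) : continuous (qform S).
Proof.
have -> : qform S = fun v => \sum_i \sum_j v 0 i * S i j * v 0 j.
  by apply/funext => v; rewrite qformE.
move=> v; apply: (@cvg_sumr _ _ _ _ (nbhs_filter v)) => i _.
apply: (@cvg_sumr _ _ _ _ (nbhs_filter v)) => j _.
apply: cvgM; last exact: coord_continuous.
by apply: cvgM; [exact: coord_continuous|exact: cvg_cst].
Qed.

(** The quotient of the two forms is continuous on the compact unit sphere and homogeneous of degree
    0, so its maximum on the sphere bounds it everywhere. *)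
Lemma rayleigh_max r (S G : 'M[R]_r.+1) : posdef G ->
  exists a, exists2 v, v != 0 &
    qform S v = a * qform G v /\ forall w, qform S w <= a * qform G w.
Proof.
move=> pG; pose A : set 'rV[R]_r.+1 := [set v | `|v| = 1].
pose h v := qform S v / qform G v.
have AN0 v : A v -> v != 0.
  by move=> /= v1; rewrite -normr_eq0 v1 oner_neq0.
have normed w : w != 0 -> A (`|w|^-1 *: w).
  by move=> w0; rewrite /A /= normrZ normfV normr_id mulVf ?normr_eq0.
have cA : compact A.
  apply: bounded_closed_compact.
    exists 1; split; first exact: num_real.
    by move=> x x1 v /= ->; exact: ltW.
  rewrite (_ : A = (fun v => `|v|) @^-1` [set 1]) //.
  apply: closed_comp => [v _|]; first exact: norm_continuous.
  exact: closed_eq.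
have A0 : A !=set0.
  exists (`|const_mx 1 : 'rV[R]_r.+1|^-1 *: const_mx 1); apply: normed.
  by apply/eqP => /matrixP/(_ 0 0)/eqP; rewrite !mxE oner_eq0.
have ch : {within A, continuous h}.
  apply: continuous_in_subspaceT => v; rewrite inE => Av.
  apply: (@cvgM _ _ _ (nbhs_filter v)); first exact: continuous_qform.
  apply: (@cvgV _ _ _ (nbhs_filter v)); last exact: continuous_qform.
  by rewrite gt_eqF // pG // AN0.
have [v vA vmax] := EVT_max_rV A0 cA ch.
rewrite inE in vA; have v0 := AN0 _ vA.
exists (h v), v => //; split; first by rewrite divfK // gt_eqF // pG.
move=> w; have [->|w0] := eqVneq w 0; first by rewrite /qform !mul0mx !mxE mulr0.
have wA : `|w|^-1 *: w \in A by rewrite inE; exact: normed.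
have := vmax _ wA; rewrite {1}/h !qform_scale -mulf_div divff ?mul1r; last first.
  by rewrite expf_neq0 // invr_neq0 // normr_eq0.
by rewrite ler_pdivrMr // pG.
Qed.

(** If a is the maximal Rayleigh quotient, [a *: G - S] is positive semidefinite and its form
    vanishes at the maximizer, which therefore lies in its kernel by [qform_null]. *)
Lemma gen_eigenvector r (S G : 'M[R]_r.+1) : S^T = S -> G^T = G -> posdef G ->
  exists a, exists2 v, qform G v = 1 & v *m S = a *: (v *m G).
Proof.
move=> sS sG pG; have [a [v v0 [Sv Sw]]] := rayleigh_max S pG.
have Nv : v *m (a *: G - S) = 0.
  apply: qform_null.
  - by rewrite linearB linearZ /= sS sG.
  - by move=> w; rewrite qformD qformZ qformN subr_ge0.
  - by rewrite qformD qformZ qformN Sv subrr.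
have q0 := pG _ v0; have s0 : 0 < Num.sqrt (qform G v) by rewrite sqrtr_gt0.
exists a, ((Num.sqrt (qform G v))^-1 *: v).
  by rewrite qform_scale exprVn sqr_sqrtr ?ltW // mulVf // gt_eqF.
move/eqP: Nv; rewrite mulmxBr subr_eq0 -scalemxAr => /eqP Nv.
by rewrite -!scalemxAl -Nv scalerA mulrC -scalerA.
Qed.

Lemma hyperplane_basis r (c : 'cV[R]_r.+1) : c != 0 ->
  exists2 W : 'M[R]_(r, r.+1), row_free W & W *m c = 0.
Proof.
move=> c0.
have : exists2 W : 'M[R]_(\rank (kermx c), r.+1), row_free W & W *m c = 0.
  exists (row_base (kermx c)); first exact: row_base_free.
  by apply/sub_kermxP; rewrite eq_row_base.
have -> // : \rank (kermx c) = r.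
rewrite mxrank_ker; suff -> : \rank c = 1%N by rewrite subn1.
by apply/eqP; rewrite eqn_leq rank_leq_col lt0n mxrank_eq0.
Qed.

Lemma block_mx_diag r (a : R) (d : 'rV[R]_r) :
  block_mx (a%:M : 'M[R]_1) 0 0 (diag_mx d) =
  diag_mx (row_mx (a%:M : 'rV[R]_1) d).
Proof.
rewrite diag_mx_row; congr block_mx.
by apply/matrixP => i j; rewrite !ord1 !mxE.
Qed.

(** Induction on the dimension: split off a generalized eigenvector v and diagonalize on its
    G-orthogonal complement, spanned by the rows of W. Since v S is a multiple of v G, this
    complement is S-orthogonal to v as well. *)
Lemma gen_spectral r (S G : 'M[R]_r) : S^T = S -> G^T = G -> posdef G ->
  exists (P : 'M[R]_r) (d : 'rV[R]_r),
    P *m G *m P^T = 1%:M /\ P *m S *m P^T = diag_mx d.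
Proof.
elim: r => [|r IH] in S G *.
  by move=> _ _ _; exists 0, 0; split; apply/matrixP => -[].
move=> sS sG pG; have [a [v v1 vS]] := gen_eigenvector sS sG pG.
have [|W fW WGv] := @hyperplane_basis r (G *m v^T).
  apply/eqP => Gv0; move: v1; rewrite /qform -mulmxA Gv0 mulmx0 mxE => /eqP.
  by rewrite eq_sym oner_eq0.
have vGW : v *m G *m W^T = 0.
  by apply: trmx_inj; rewrite !trmx_mul !trmxK sG WGv trmx0.
have GW : v *m G *m v^T = 1%:M.
  by apply/matrixP => i j; rewrite !ord1 [LHS]v1 mxE.
have WSv : W *m S *m v^T = 0.
  apply: trmx_inj; rewrite !trmx_mul trmxK sS mulmxA vS -scalemxAl vGW scaler0.
  by rewrite trmx0.
have [|||P [d [PG PS]]] := IH (W *m S *m W^T) (W *m G *m W^T).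
- by rewrite !trmx_mul trmxK sS mulmxA.
- by rewrite !trmx_mul trmxK sG mulmxA.
- exact: posdef_congr.
have cong (T : 'M[R]_(1 + r)) b D : v *m T *m v^T = b%:M -> v *m T *m W^T = 0 ->
    W *m T *m v^T = 0 -> P *m (W *m T *m W^T) *m P^T = D ->
    col_mx v (P *m W) *m T *m (col_mx v (P *m W))^T =
    block_mx b%:M 0 0 D.
  move=> e1 e2 e3 e4; rewrite mul_col_mx tr_col_mx mul_col_row e1.
  congr block_mx; last by rewrite -e4 trmx_mul !mulmxA.
  - by rewrite trmx_mul mulmxA e2 mul0mx.
  - by rewrite -!mulmxA [W *m _]mulmxA e3 mulmx0.
exists (col_mx v (P *m W)), (row_mx (a%:M) d); split.
- rewrite (cong _ 1 1%:M) //.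
  + by rewrite -scalar_mx_block.
  + by rewrite -mulmxA WGv.
- rewrite (cong _ a (diag_mx d)) //.
  + exact: block_mx_diag.
  + by rewrite vS -scalemxAl GW scale_scalar_mx mulr1.
  + by rewrite vS -scalemxAl vGW scaler0.
Qed.

End quadratic_forms.

(** * Inertia: negative eigenvalues under congruence and perturbation *)

Section inertia.
Context {R : realType}.
Implicit Types (r q n : nat).

Lemma char_poly_conj r (P A : 'M[R]_r) : P \in unitmx ->
  char_poly (invmx P *m A *m P) = char_poly A.
Proof.
move=> uP; rewrite /char_poly /char_poly_mx !map_mxM.
set Pp := map_mx polyC P; set Pi := map_mx polyC (invmx P).
have PiP : Pi *m Pp = 1%:M by rewrite -map_mxM mulVmx // map_mx1.
have -> : 'X%:M - Pi *m map_mx polyC A *m Pp =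
    Pi *m ('X%:M - map_mx polyC A) *m Pp.
  by rewrite mulmxBr mulmxBl mul_mx_scalar -scalemxAl PiP scalemx1.
rewrite !det_mulmx mulrAC -det_mulmx PiP det1 mul1r //.
Qed.

Lemma num_neg_conj r (P A : 'M[R]_r) : P \in unitmx ->
  num_neg_eigenvalues (invmx P *m A *m P) = num_neg_eigenvalues A.
Proof. by move=> uP; rewrite /num_neg_eigenvalues char_poly_conj. Qed.

Lemma num_neg_diag r (d : 'rV[R]_r) :
  num_neg_eigenvalues (diag_mx d) = #|[set i | d 0 i < 0]%SET|.
Proof.
rewrite /num_neg_eigenvalues; set p := char_poly _.
pose s := [seq d 0 i | i <- enum 'I_r].
have pE : p = \prod_(y <- s) ('X - y%:P).
  rewrite /p char_poly_trig ?diag_mx_is_trig // big_map big_enum /=.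
  by apply: eq_bigr => i _; rewrite mxE eqxx.
have p0 : p != 0 by rewrite monic_neq0 // char_poly_monic.
have memr a : (a \in polyrcf.rootsR p) = (a \in s).
  by rewrite -(polyrcf.roots_on_rootsR p0) in_itv /= pE root_prod_XsubC.
have ur : uniq (polyrcf.rootsR p) by exact: polyrcf.uniq_roots.
rewrite (eq_bigr (fun a => count_mem a s)); last first.
  by move=> a _; rewrite pE mu_prod_XsubC.
have -> : #|[set i | d 0 i < 0]%SET| = count (fun y => y < 0) s.
  rewrite -sum1_card -sum1_count big_map big_enum_cond /=.
  by apply: eq_bigl => i; rewrite !inE.
under eq_bigr do rewrite -sum1_count.
rewrite (exchange_big_dep (fun y => y < 0)) /=; last first.
  by move=> a y a0 /eqP ->.
rewrite -sum1_count big_seq_cond [RHS]big_seq_cond; apply: eq_bigr => y /andP[ys y0].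
rewrite (eq_bigl (pred1 y)); last first.
  by move=> a /=; rewrite [y == a]eq_sym andb_idl // => /eqP ->.
by rewrite sum1_count count_uniq_mem // memr ys.
Qed.

(** From P G P^T = 1 follows G^-1 = P^T P, so S G^-1 is similar, through P, to the diagonal matrix
    of d. *)
Lemma gen_spectral_num_neg r (S G P : 'M[R]_r) (d : 'rV[R]_r) :
    G \in unitmx -> P *m G *m P^T = 1%:M -> P *m S *m P^T = diag_mx d ->
  num_neg_eigenvalues (S *m invmx G) = #|[set i | d 0 i < 0]%SET| /\
  ((S *m invmx G \in unitmx) = [forall i, d 0 i != 0]).
Proof.
move=> uG PG PS.
have [uP _] : P \in unitmx /\ G *m P^T \in unitmx.
  by apply: mulmx1_unit; rewrite mulmxA.
have uPT : P^T \in unitmx by rewrite unitmx_tr.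
have GV : invmx G = P^T *m P.
  apply: (can_inj (mulKmx uG)); rewrite mulmxV // mulmxA.
  by apply: (can_inj (mulKmx uP)); rewrite !mulmxA PG mulmx1 mul1mx.
have -> : S *m invmx G = invmx P *m diag_mx d *m P.
  by rewrite -PS !mulmxA mulVmx // mul1mx GV !mulmxA.
split; first by rewrite num_neg_conj // num_neg_diag.
rewrite !unitmx_mul uP unitmx_inv uP andbT /= unitmxE det_diag unitfE.
apply/prodf_neq0/forallP => [h i|h i _]; exact: h.
Qed.

(** One half of Sylvester's law of inertia. If q exceeded the number of negative entries, some
    nonzero c would give a vector [c *m N] whose coordinates in the rows of P vanish wherever d is
    negative, and the form would be nonnegative there. *)
Lemma neg_dim r q (S P : 'M[R]_r) (d : 'rV[R]_r) (N : 'M[R]_(q, r)) :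
    P \in unitmx -> P *m S *m P^T = diag_mx d ->
    (forall c, c != 0 -> qform (N *m S *m N^T) c < 0) ->
  (q <= #|[set i | (d 0 i < 0)%R]%SET|)%N.
Proof.
move=> uP PS negN; set I := [set i | _]%SET; rewrite leqNgt; apply/negP => ltIq.
pose E := \matrix_(i < q, j < #|I|) ((N *m invmx P) i (enum_val j)).
have : kermx E != 0.
  rewrite -mxrank_eq0 mxrank_ker -lt0n subn_gt0.
  exact: leq_ltn_trans (rank_leq_col _) ltIq.
case/rowV0Pn => c /sub_kermxP cE c0.
have := negN c c0; rewrite qform_congr.
set y := c *m N *m invmx P.
have -> : c *m N = y *m P by rewrite /y mulmxKV.
rewrite -qform_congr PS ltNge => /negP; apply.
have y0 i : d 0 i < 0 -> y 0 i = 0.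
  move=> di; have iI : i \in I by rewrite inE.
  have : (c *m E) 0 (enum_rank_in iI i) = 0 by rewrite cE mxE.
  rewrite mxE => h; rewrite /y -mulmxA mxE -[RHS]h; apply: eq_bigr => k _.
  by rewrite [E _ _]mxE enum_rankK_in.
rewrite qformE sumr_ge0 // => i _; rewrite (bigD1 i) //= big1 ?addr0 => [|j ji].
  rewrite [diag_mx d i i]mxE eqxx mulr1n.
  have [/y0 ->|di] := ltP (d 0 i) 0; first by rewrite !mul0r.
  by rewrite mulrAC mulr_ge0 // -expr2 sqr_ge0.
by rewrite [diag_mx d i j]mxE eq_sym (negPf ji) mulr0n mulr0 mul0r.
Qed.

Lemma qform_le r (E : 'M[R]_r) e c : (forall i j, `|E i j| <= e) ->
  `|qform E c| <= e * r%:R * (c *m c^T) 0 0.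
Proof.
move=> Ee; rewrite qformE (le_trans (ler_norm_sum _ _ _)) //.
apply: (@le_trans _ _ (\sum_i \sum_j (e / 2 * (c 0 i ^+ 2 + c 0 j ^+ 2)))).
  apply: ler_sum => i _; rewrite (le_trans (ler_norm_sum _ _ _)) //.
  apply: ler_sum => j _; rewrite !normrM.
  have := Ee i j; have := normr_ge0 (E i j).
  rewrite -[c 0 i ^+ 2]real_normK ?num_real // -[c 0 j ^+ 2]real_normK ?num_real //.
  move: `|E i j| `|c 0 i| `|c 0 j| => x a b x0 xe.
  have := sqr_ge0 (a - b); have : 0 <= e by exact: le_trans xe.
  nra.
under eq_bigr do rewrite -mulr_sumr big_split /= sumr_const card_ord.
rewrite -mulr_sumr big_split /= sumr_const card_ord -sqr_norm_row.
set a := (c *m c^T) 0 0.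
have -> : \sum_(i < r) c 0 i ^+ 2 *+ r = a * r%:R.
  rewrite /a sqr_norm_row mulr_suml; apply: eq_bigr => i _.
  by rewrite mulr_natr.
by rewrite -[a *+ r]mulr_natr le_eqVlt; apply/orP; left; apply/eqP; field.
Qed.

(** By [qform_le] the perturbation adds at most e r per squared coordinate, which is less than what
    each negative entry of d subtracts. *)
Lemma perturbed_diag_neg r (d y : 'rV[R]_r) (E : 'M[R]_r) (e : R) :
    (forall i j, `|E i j| <= e) -> (forall i, e * r%:R < `|d 0 i|) ->
    (forall i, y 0 i != 0 -> d 0 i < 0) -> y != 0 ->
  qform (diag_mx d + E) y < 0.
Proof.
move=> Ee ed yd y0; rewrite qformD.
have -> : qform (diag_mx d) y = \sum_i d 0 i * y 0 i ^+ 2.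
  rewrite qformE; apply: eq_bigr => i _.
  rewrite (bigD1 i) //= big1 ?addr0 => [|j ji].
    by rewrite [diag_mx d i i]mxE eqxx mulr1n mulrAC -expr2 mulrC.
  by rewrite [diag_mx d i j]mxE eq_sym (negPf ji) mulr0n mulr0 mul0r.
have := qform_le y Ee; rewrite sqr_norm_row => /ler_normlW/(lerD (lexx _)).
move=> /(_ (\sum_i d 0 i * y 0 i ^+ 2))/le_lt_trans; apply.
rewrite mulr_sumr -big_split /=.
have le0 i : d 0 i * y 0 i ^+ 2 + e * r%:R * y 0 i ^+ 2 <= 0.
  have [->|yi] := eqVneq (y 0 i) 0; first by rewrite expr0n /= !mulr0 addr0.
  rewrite -mulrDl nmulr_rle0 ?sqr_ge0 // -ltrBrDl sub0r.
  by have := ed i; rewrite ltr0_norm // yd.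
have [i yi] : exists i, y 0 i != 0 by apply/rV0Pn.
rewrite (bigD1 i) //= ltr_nwDl ?sumr_le0 // -mulrDl nmulr_rlt0.
  by rewrite lt_def sqr_ge0 sqrf_eq0 yi.
by rewrite -ltrBrDl sub0r; have := ed i; rewrite ltr0_norm // yd.
Qed.

(** The rows of P at which d is negative span a subspace where S is still negative definite;
    [neg_dim], in the diagonalization by Q, bounds its dimension. *)
Lemma perturbed_neg_count r (S P Q : 'M[R]_r) (d d' : 'rV[R]_r)
    (e : R) :
    (forall i j, `|(P *m S *m P^T - diag_mx d) i j| <= e) ->
    (forall i, e * r%:R < `|d 0 i|) ->
    Q \in unitmx -> Q *m S *m Q^T = diag_mx d' ->
  (#|[set i | (d 0 i < 0)%R]%SET| <= #|[set i | (d' 0 i < 0)%R]%SET|)%N.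
Proof.
move=> Ee ed uQ QS; set A := [set i | (d 0 i < 0)%R]%SET.
pose M : 'M[R]_(#|A|, r) := \matrix_(i, j) (j == enum_val i)%:R.
apply: (@neg_dim r #|A| S Q d' (M *m P)) => // c c0.
rewrite qform_congr mulmxA -qform_congr -[P *m _ *m _](subrK (diag_mx d)) addrC.
have cM i : (c *m M) 0 (enum_val i) = c 0 i.
  rewrite mxE (bigD1 i) //= [M _ _]mxE eqxx mulr1 big1 ?addr0 // => j ji.
  by rewrite [M _ _]mxE (inj_eq enum_val_inj) eq_sym (negPf ji) mulr0.
apply: perturbed_diag_neg Ee ed _ _.
  move=> i; apply: contra_neqT => iA; rewrite mxE big1 // => j _.
  rewrite [M _ _]mxE; case: eqP => [ij|]; rewrite ?mulr0 //.
  by have := enum_valP j; rewrite -ij inE (negPf iA).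
apply: contra_neq c0 => cM0; apply/rowP => i.
by rewrite -cM cM0 !mxE.
Qed.

(* At least as many eigenvalues stay negative, and at least as many stay      *)
(* positive; as none of the original ones vanishes, both counts are preserved. *)
Lemma num_neg_stable r T (F : set_system T) (FF : Filter F)
    (S G : T -> 'M[R]_r) (S0 G0 : 'M[R]_r) :
    S0^T = S0 -> G0^T = G0 -> posdef G0 -> S0 *m invmx G0 \in unitmx ->
    (\forall z \near F, [/\ (S z)^T = S z, (G z)^T = G z & posdef (G z)]) ->
    (forall i j, S z i j @[z --> F] --> S0 i j) ->
  \forall z \near F, S z *m invmx (G z) \in unitmx /\
    num_neg_eigenvalues (S z *m invmx (G z)) =
    num_neg_eigenvalues (S0 *m invmx G0).
Proof.
move=> sS0 sG0 pG0 uS0 symF cS.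
have [P [d [PG PS]]] := gen_spectral sS0 sG0 pG0.
have [n0 u0] := gen_spectral_num_neg (posdef_unit pG0) PG PS.
move: uS0; rewrite u0 => /forallP d0.
have [e e0 ed] : exists2 e : R, 0 < e & forall i, e * r%:R < `|d 0 i|.
  pose b := \big[Num.min/1]_i `|d 0 i|.
  have b0 : 0 < b.
    by rewrite /b; elim/big_ind: _ => // [x y x0 y0|i _];
      rewrite ?lt_min ?x0 ?y0 ?normr_gt0.
  (* Dividing by r + 1 instead of r makes the bound strict and covers r = 0. *)
  exists (b / r.+1%:R) => [|i]; first by rewrite divr_gt0 ?ltr0n.
  rewrite mulrAC ltr_pdivrMr ?ltr0n // (@lt_le_trans _ _ (b * r.+1%:R)) //.
    by rewrite ltr_pM2l // ltr_nat.
  by rewrite ler_pM2r ?ltr0n // bigmin_le_cond.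
have cP i j : (P *m S z *m P^T) i j @[z --> F] --> (diag_mx d) i j.
  rewrite -PS mxE; under eq_cvg do rewrite mxE.
  apply: cvg_sumr => k _; apply: cvgM; last exact: cvg_cst.
  rewrite mxE; under eq_cvg do rewrite mxE.
  by apply: cvg_sumr => l _; apply: cvgM; [exact: cvg_cst|exact: cS].
have cE : \forall z \near F, forall i j,
    `|(P *m S z *m P^T - diag_mx d) i j| <= e.
  apply: filter_forall => i; apply: filter_forall => j.
  have /cvgrPdist_le/(_ _ e0) := cP i j.
  apply: filterS => z; rewrite distrC.
  by rewrite [X in _ -> `|X| <= _]mxE [(- diag_mx d) i j]mxE.
move: cE symF; apply: filterS2 => z Ez [sS sG pG].
have [Q [d' [QG QS]]] := gen_spectral sS sG pG.
have [uQ _] : Q \in unitmx /\ G z *m Q^T \in unitmx.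
  by apply: mulmx1_unit; rewrite mulmxA.
have [n1 u1] := gen_spectral_num_neg (posdef_unit pG) QG QS.
rewrite u1 n0 n1.
have neg := perturbed_neg_count Ez ed uQ QS.
(* Positive entries are the negative ones of the opposite form. As d has no zero entry, the two
   inequalities and the total count r leave no slack. *)
have {}pos : (#|[set i | (0 < d 0 i)%R]%SET| <= #|[set i | (0 < d' 0 i)%R]%SET|)%N.
  have := @perturbed_neg_count r (- S z) P Q (- d) (- d') e.
  have -> : P *m (- S z) *m P^T - diag_mx (- d) = - (P *m S z *m P^T - diag_mx d).
    by rewrite mulmxN mulNmx linearN opprD.
  have -> : Q *m (- S z) *m Q^T = diag_mx (- d').
    by rewrite mulmxN mulNmx QS linearN.
  move=> h; apply: leq_trans (leq_trans (h _ _ uQ erefl) _).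
  - by apply: subset_leq_card; apply/fintype.subsetP => i; rewrite !inE mxE oppr_lt0.
  - by move=> i j; rewrite mxE normrN.
  - by move=> i; rewrite mxE normrN.
  - by apply: subset_leq_card; apply/fintype.subsetP => i; rewrite !inE mxE oppr_lt0.
have tri (x : 'rV[R]_r) : r = (#|[set i | (x 0 i < 0)%R]%SET| +
    #|[set i | (0 < x 0 i)%R]%SET| + #|[set i | (x 0 i == 0)%R]%SET|)%N.
  transitivity (\sum_(i < r) ((x 0 i < 0)%R + (0 < x 0 i)%R + (x 0 i == 0)%R))%N.
    rewrite -{1}[r]card_ord -sum1_card; apply: eq_bigr => i _.
    by case: (ltgtP (x 0 i) 0).
  rewrite !big_split /= -!sum1_card; congr (_ + _ + _)%N;
    by rewrite [RHS]big_mkcond; apply: eq_bigr => i _; rewrite inE; case: ifP.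
have z0 : #|[set i | (d 0 i == 0)%R]%SET| = 0%N.
  by apply: eq_card0 => i; rewrite !inE (negPf (d0 i)).
have := tri d; rewrite {1}(tri d') z0 => tr.
split; last by lia.
apply/forallP => i; apply/negP => di.
have : #|[set i | (d' 0 i == 0)%R]%SET| == 0%N by apply/eqP; lia.
by rewrite cards_eq0 => /eqP/finset.setP/(_ i); rewrite !inE di.
Qed.

(** Two bases of the same space differ by an invertible factor C on the left, and the matrices of
    the restricted operator are then conjugate by C. *)
Lemma restrict_form_basis n r (H T : 'M[R]_n) (B : 'M[R]_(r, n)) :
    row_free B -> (B :=: T)%MS ->
  num_neg_eigenvalues (restrict_form H T) =
    num_neg_eigenvalues (B *m H *m B^T *m invmx (B *m B^T)) /\
  (restrict_form H T \in unitmx) =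
    (B *m H *m B^T *m invmx (B *m B^T) \in unitmx).
Proof.
move=> fB BT; have rT : \rank T = r by rewrite -BT; exact/eqP.
rewrite /restrict_form; move: (row_base T) (row_base_free T) (eq_row_base T).
rewrite rT => B' fB' B'T.
have [C BC] : exists C, B' = C *m B by apply/submxP; rewrite BT B'T.
have uC : C \in unitmx.
  rewrite -row_free_unit -row_leq_rank.
  move: fB'; rewrite -row_leq_rank BC => /leq_trans; apply.
  exact: mxrankM_maxl.
have uG : B *m B^T \in unitmx by apply: posdef_unit; exact: posdef_gram.
have uCT : C^T \in unitmx by rewrite unitmx_tr.
have -> : invmx (B' *m B'^T) = invmx C^T *m invmx (B *m B^T) *m invmx C.
  have e : B' *m B'^T = C *m (B *m B^T) *m C^T by rewrite BC trmx_mul !mulmxA.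
  have u : B' *m B'^T \in unitmx by rewrite e !unitmx_mul uC uG.
  apply: (can_inj (mulKmx u)); rewrite mulmxV // e.
  by rewrite !mulmxA !(mulmxK, mulmxKV) // -[C *m B *m B^T]mulmxA mulmxK // mulmxV.
set X := B *m H *m B^T *m invmx (B *m B^T).
have -> : B' *m H *m B'^T *m (invmx C^T *m invmx (B *m B^T) *m invmx C) =
    invmx (invmx C) *m X *m invmx C.
  rewrite invmxK BC trmx_mul /X !mulmxA; congr (_ *m _ *m _).
  by rewrite -!mulmxA mulmxV // mulmx1.
by rewrite num_neg_conj ?unitmx_inv // !unitmx_mul !unitmx_inv uC andbT.
Qed.

End inertia.

(** * Limits of matrices and strict differentiability *)

Section matrix_limits.
Context {R : realType} {T : Type} {F : set_system T} {FF : Filter F}.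

Lemma cvg_mulmx m n p (A : T -> 'M[R]_(m, n)) (B : T -> 'M[R]_(n, p))
    (A0 : 'M[R]_(m, n)) (B0 : 'M[R]_(n, p)) :
    (forall i j, A z i j @[z --> F] --> A0 i j) ->
    (forall i j, B z i j @[z --> F] --> B0 i j) ->
  forall i j, (A z *m B z) i j @[z --> F] --> (A0 *m B0) i j.
Proof.
move=> cA cB i j; rewrite mxE; under eq_cvg do rewrite mxE.
by apply: cvg_sumr => k _; apply: cvgM.
Qed.

Lemma cvg_det n (A : T -> 'M[R]_n) (A0 : 'M[R]_n) :
    (forall i j, A z i j @[z --> F] --> A0 i j) ->
  \det (A z) @[z --> F] --> \det A0.
Proof.
move=> cA; apply: cvg_sumr => s _; apply: cvgM; first exact: cvg_cst.
by apply: cvg_prodr => i _.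
Qed.

Lemma near_unitmx n (A : T -> 'M[R]_n) (A0 : 'M[R]_n) :
    (forall i j, A z i j @[z --> F] --> A0 i j) -> A0 \in unitmx ->
  \forall z \near F, A z \in unitmx.
Proof.
move=> /cvg_det/cvgrPdist_lt cA; rewrite unitmxE unitfE -normr_gt0 => /cA.
apply: filterS => z; rewrite unitmxE unitfE; apply: contraTneq => ->.
by rewrite subr0 ltxx.
Qed.

Lemma cvg_invmx n (A : T -> 'M[R]_n) (A0 : 'M[R]_n) :
    (forall i j, A z i j @[z --> F] --> A0 i j) -> A0 \in unitmx ->
  forall i j, invmx (A z) i j @[z --> F] --> invmx A0 i j.
Proof.
move=> cA uA0 i j; have uA := near_unitmx cA uA0.
rewrite /invmx uA0 mxE mxE.
have h : (\det (A z))^-1 * cofactor (A z) j i @[z --> F] -->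
    (\det A0)^-1 * cofactor A0 j i.
  apply: cvgM; first by apply: cvgV (cvg_det cA); rewrite -unitfE -unitmxE.
  apply: cvgM; first exact: cvg_cst.
  apply: cvg_det => k l.
  have e B : (row' j (col' i B)) k l = B (lift j k) (lift i l) by rewrite !mxE.
  by rewrite e; under eq_cvg do rewrite e; exact: cA.
(* [invmx] is given by the cofactor formula only at invertible matrices, hence only near the
   limit. *)
apply: cvg_trans h; apply: near_eq_cvg; move: uA; apply: filterS => z uz.
by rewrite /invmx uz !mxE.
Qed.

End matrix_limits.

Section row_norms.
Context {R : realType}.
Implicit Types (m n : nat).

Lemma mx_norm_le m n (A : 'M[R]_(m, n)) (c : R) : 0 <= c ->
  (forall i j, `|A i j| <= c) -> `|A| <= c.
Proof.
move=> c0 Ac; rewrite [leLHS]/Num.Def.normr /= mx_normrE.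
by apply/bigmax_leP; split => // -[i j] _ /=.
Qed.

Lemma mx_entry_norm_le m n (A : 'M[R]_(m, n)) i j : `|A i j| <= `|A|.
Proof.
rewrite [leRHS]/Num.Def.normr /= mx_normrE.
by apply/bigmax_geP; right; exists (i, j).
Qed.

Lemma mulmx_bounded m n (A : 'M[R]_(m, n)) :
  exists2 c, 0 < c & forall x : 'rV[R]_m, `|x *m A| <= c * `|x|.
Proof.
exists (1 + \sum_i \sum_j `|A i j|) => [|x].
  by rewrite ltr_wpDr // sumr_ge0 // => i _; rewrite sumr_ge0.
have s0 : 0 <= \sum_i \sum_j `|A i j| by rewrite sumr_ge0 // => i _; rewrite sumr_ge0.
apply: mx_norm_le => [|i j]; first by rewrite mulr_ge0 // addr_ge0.
rewrite !ord1 mxE (le_trans (ler_norm_sum _ _ _)) // mulrDl mul1r mulr_suml.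
rewrite -[leLHS]add0r lerD // ler_sum // => k _.
rewrite normrM mulrC ler_pM // ?mx_entry_norm_le //.
by rewrite (bigD1 j) //= lerDl sumr_ge0.
Qed.

Lemma norm_delta_row n (i : 'I_n) : `|delta_mx 0 i : 'rV[R]_n| <= 1 :> R.
Proof.
by apply: mx_norm_le => // a b; rewrite mxE; case: (_ && _); rewrite ?normr1 ?normr0.
Qed.

Lemma norm_row_mx n p (a : 'rV[R]_n) (b : 'rV[R]_p) :
  `|row_mx a b| = Num.max `|a| `|b|.
Proof.
apply/le_anti/andP; split.
  apply: mx_norm_le => [|i j]; first by rewrite le_max normr_ge0.
  by case: (split_ordP j) => k ->; rewrite ?row_mxEl ?row_mxEr le_max
    mx_entry_norm_le ?orbT.
rewrite ge_max; apply/andP; split; apply: mx_norm_le => // i j.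
  by rewrite -(row_mxEl a b) mx_entry_norm_le.
by rewrite -(row_mxEr a b) mx_entry_norm_le.
Qed.

Lemma nbhs_rowP n (x : 'rV[R]_n) (P : set 'rV[R]_n) :
  (\forall y \near x, P y) <-> exists2 d, 0 < d & forall y, `|y - x| < d -> P y.
Proof.
split=> [/nbhs_ballP[d d0 h]|[d d0 h]].
  by exists d => // y; rewrite distrC => yx; apply: h; rewrite -ball_normE.
apply/nbhs_ballP; exists d => // y; rewrite -ball_normE /= distrC; exact: h.
Qed.

End row_norms.

(** Joins completeness with the norm, so that [banach_fixed_point] applies to row vectors. *)
HB.instance Definition _ (R : realType) m n := Complete.on 'M[R]_(m, n).

(** * Strict differentiability, symmetry of the Hessian, and local inversion *)

Section strict_differentiability.
Context {R : realType}.
Implicit Types (m n : nat).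

(* L is the transposed gradient; unlike in mere differentiability at x, both  *)
(* u and v vary.                                                              *)
Definition strict_diff n (g : 'rV[R]_n -> R) (x : 'rV[R]_n) (L : 'cV[R]_n) :=
  forall e, 0 < e -> exists2 d, 0 < d & forall u v, `|u - x| < d ->
    `|v - x| < d -> `|g u - g v - ((u - v) *m L) 0 0| <= e * `|u - v|.

Lemma derive_grad n (g : 'rV[R]_n -> R) x v : differentiable g x ->
  'D_v g x = (v *m (grad g x)^T) 0 0.
Proof.
move=> dg; rewrite mxE deriveE // [in LHS](row_sum_delta v) linear_sum /=.
by apply: eq_bigr => i _; rewrite !mxE linearZ /= /partial deriveE.
Qed.

Lemma is_derive_line n (g : 'rV[R]_n -> R) (a w : 'rV[R]_n) (s : R) :
  differentiable g (a + s *: w) ->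
  is_derive s 1 (fun s => g (a + s *: w)) ('D_w g (a + s *: w)).
Proof.
move=> /(@diff_derivable _ _ _ _ _ w) dg.
have e : (fun h : R => h^-1 *: (g (a + (h *: 1 + s) *: w) - g (a + s *: w))) =
    (fun h => h^-1 *: (g (h *: w + (a + s *: w)) - g (a + s *: w))).
  apply/funext => h; congr (_ *: (g _ - _)).
  by rewrite scalerDl addrCA [h *: 1]mulr1.
by apply: DeriveDef; rewrite /derivable /derive e.
Qed.

Lemma derive_translate n (g : 'rV[R]_n -> R) (b v x : 'rV[R]_n) :
  'D_v (fun y => g (y + b)) x = 'D_v g (x + b).
Proof.
have e : (fun h : R => h^-1 *: (g (h *: v + x + b) - g (x + b))) =
    (fun h => h^-1 *: (g (h *: v + (x + b)) - g (x + b))).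
  by apply/funext => h; rewrite addrA.
by rewrite /derive e.
Qed.

Lemma line_MVT n (g : 'rV[R]_n -> R) (a w : 'rV[R]_n) (s : R) :
    (forall x, differentiable g x) -> 0 <= s ->
  exists2 c, c \in `[0, s] &
    g (a + s *: w) - g a = 'D_w g (a + c *: w) * s.
Proof.
move=> dg s0.
have [|c cs e] := @MVT_segment R (fun s => g (a + s *: w))
  (fun s => 'D_w g (a + s *: w)) 0 s s0 (fun x _ => is_derive_line (dg _)) _.
- apply: continuous_subspaceT => r.
  apply: differentiable_continuous; apply/derivable1_diffP.
  by case: (is_derive_line (dg (a + r *: w))).
- by exists c => //; move: e; rewrite scale0r addr0 subr0.
Qed.

(** The mean value theorem on the segment from v to u expresses the error through the variation of
    the gradient, which is small on a ball around x. *)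
Lemma C1_strict_diff n (g : 'rV[R]_n -> R) x : C1 g ->
  strict_diff g x (grad g x)^T.
Proof.
move=> [dg cg] e e0.
have e1 : 0 < e / n.+1%:R by rewrite divr_gt0 ?ltr0n.
have : \forall y \near x, forall i, `|partial g i x - partial g i y| < e / n.+1%:R.
  apply: (@filter_forall _ _ _ (nbhs x)) => i.
  by move/cvgrPdist_lt: (cg i x) => /(_ _ e1).
move=> /nbhs_rowP[d d0 dP]; exists d => // u v ux vx.
have [c] := @line_MVT n g v (u - v) 1 dg ler01.
rewrite in_itv /= => /andP[c0 c1]; rewrite scale1r [v + (u - v)]addrC subrK mulr1 => ->.
rewrite derive_grad // -[X in `|X|](_ : ((u - v) *m
  ((grad g (v + c *: (u - v)))^T - (grad g x)^T)) 0 0 = _); last first.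
  by rewrite mulmxBr [LHS]mxE [X in _ + X]mxE.
rewrite mxE (le_trans (ler_norm_sum _ _ _)) //.
apply: (@le_trans _ _ (\sum_(i < n) `|u - v| * (e / n.+1%:R))); last first.
  rewrite sumr_const card_ord mulrC -mulrnAl -mulr_natr ler_wpM2r //.
  rewrite mulrAC ler_pdivrMr ?ltr0n // ler_pM2l // ler_nat //.
apply: ler_sum => i _; rewrite normrM ler_pM // ?mx_entry_norm_le //.
rewrite !mxE distrC ltW // dP //.
(* The intermediate point stays in the ball by convexity. *)
have -> : v + c *: (u - v) - x = (1 - c) *: (v - x) + c *: (u - x).
  by apply/rowP => k; rewrite !mxE; ring.
apply: le_lt_trans (ler_normD _ _) _; rewrite !normrZ ger0_norm ?subr_ge0 //.
rewrite (ger0_norm c0); pose M := Num.max `|v - x| `|u - x|.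
have Md : M < d by rewrite gt_max vx.
apply: le_lt_trans Md; rewrite -[leRHS](_ : (1 - c) * M + c * M = M); last by ring.
by rewrite lerD // ler_wpM2l ?subr_ge0 // le_max lexx ?orbT.
Qed.

(** The second difference is the increment in direction i of h(y) = g(y + s e_j) - g(y). The mean
    value theorem turns it into s times an increment of the i-th partial derivative over s e_j,
    which strict differentiability evaluates. *)
Lemma second_difference n (g : 'rV[R]_n -> R) x i j : C2 g -> forall e, 0 < e ->
  exists2 d, 0 < d & forall s, 0 < s < d ->
  `|g (x + s *: delta_mx 0 i + s *: delta_mx 0 j) - g (x + s *: delta_mx 0 i)
     - g (x + s *: delta_mx 0 j) + g x
     - s ^+ 2 * partial (partial g i) j x| <= e * s ^+ 2.
Proof.
move=> [[dg _] C1g] e e0.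
have [d d0 dP] := C1_strict_diff x (C1g i) e0.
(* The points involved are within 2 s of x. *)
exists (d / 2) => [|s /andP[s0 sd]]; first by rewrite divr_gt0.
pose ei : 'rV[R]_n := delta_mx 0 i; pose ej : 'rV[R]_n := delta_mx 0 j.
pose h := (fun y => g (y + s *: ej)) - g.
have dh y : differentiable h y.
  apply: differentiableB => //; apply: differentiable_comp => //.
have [c] := @line_MVT n h x ei s dh (ltW s0).
rewrite in_itv /= => /andP[c0 cs] hE.
have -> : g (x + s *: ei + s *: ej) - g (x + s *: ei) - g (x + s *: ej) + g x =
    h (x + s *: ei) - h x by rewrite /h !fctE; ring.
rewrite hE.
have -> : 'D_ei h (x + c *: ei) =
    partial g i (x + c *: ei + s *: ej) - partial g i (x + c *: ei).
  rewrite /h deriveB ?derive_translate //; last exact: diff_derivable.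
  by apply: diff_derivable; exact: differentiable_comp.
have := dP (x + c *: ei + s *: ej) (x + c *: ei).
have -> : x + c *: ei + s *: ej - (x + c *: ei) = s *: ej by rewrite addrC addKr.
have nei := norm_delta_row i : `|ei| <= 1; have nej := norm_delta_row j : `|ej| <= 1.
have -> : ((s *: ej) *m (grad (partial g i) x)^T) 0 0 = s * partial (partial g i) j x.
  rewrite -scalemxAl mxE -derive_grad //; exact: (C1g i).1.
have cn : `|c *: ei| <= s.
  by rewrite normrZ ger0_norm // -[s]mulr1 ler_pM.
have sn : `|s *: ej| <= s.
  by rewrite normrZ gtr0_norm // -[leRHS]mulr1 ler_wpM2l // ltW.
rewrite [x + c *: ei + _ - x]addrAC [x + c *: ei]addrC addrK => h1.
rewrite -[X in _ - X](_ : (s * partial (partial g i) j x) * s = _); last by ring.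
rewrite -mulrBl normrM (gtr0_norm s0) expr2 mulrA ler_wpM2r ?(ltW s0) //.
apply: le_trans (h1 _ _) _.
- apply: le_lt_trans (ler_normD _ _) _; lra.
- lra.
- by rewrite ler_wpM2l // ltW.
Qed.

(** The second difference is symmetric in i and j, so both mixed derivatives approximate the same
    number up to an arbitrary e. *)
Lemma hess_sym n (g : 'rV[R]_n -> R) x : C2 g -> (hess g x)^T = hess g x.
Proof.
move=> C2g; apply/matrixP => i j; rewrite !mxE.
set a := partial _ _ _; set b := partial _ _ _.
apply/eqP; rewrite -subr_eq0 -normr_le0; apply/ler_addgt0Pl => e e0; rewrite addr0.
have e2 : 0 < e / 2 by rewrite divr_gt0.
have [d1 d10 h1] := second_difference x i j C2g e2.
have [d2 d20 h2] := second_difference x j i C2g e2.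
pose s := Num.min d1 d2 / 2.
have s0 : 0 < s by rewrite divr_gt0 // lt_min d10.
have := h1 s; have := h2 s.
rewrite s0 /= [x + _ + _]addrAC => /(_ _) h2s /(_ _) h1s.
have m1 : Num.min d1 d2 <= d1 by rewrite ge_min lexx.
have m2 : Num.min d1 d2 <= d2 by rewrite ge_min lexx orbT.
have half d : Num.min d1 d2 <= d -> s < d.
  move=> md; rewrite ltr_pdivrMr // (le_lt_trans md) // ltr_pMr ?ltr1n //.
  by rewrite (lt_le_trans _ md) // lt_min d10.
have {}h1s := h1s (half _ m1); have {}h2s := h2s (half _ m2).
rewrite [_ - _ - g (x + s *: delta_mx 0 i)]addrAC in h2s.
move: h1s h2s; set D := _ + g x; rewrite -/a -/b => h1s h2s.
clearbody s a b D.
have s2 : 0 < s ^+ 2 by rewrite exprn_gt0.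
rewrite -(ler_pM2l s2) -[s ^+ 2 in leLHS]gtr0_norm // -normrM.
rewrite (_ : s ^+ 2 * (a - b) = (D - s ^+ 2 * b) - (D - s ^+ 2 * a)); last by ring.
apply: le_trans (ler_normB _ _) _.
rewrite (_ : s ^+ 2 * e = e / 2 * s ^+ 2 + e / 2 * s ^+ 2); last by field.
exact: (lerD h2s h1s).
Qed.

(** Solutions of Phi u = w are the fixed points of the simplified Newton map T w u = u - (Phi u - w)
    K^-1, which strict differentiability makes a contraction near z. Injectivity holds on one ball
    of radius d, while a preimage can be found as close to z as desired. *)
Lemma strict_diff_local_inverse n (Phi : 'rV[R]_n -> 'rV[R]_n) z (K : 'M[R]_n) :
    K \in unitmx -> (forall i, strict_diff (fun y => Phi y 0 i) z (col i K)) ->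
  exists2 d, 0 < d &
    (forall u v, `|u - z| < d -> `|v - z| < d -> Phi u = Phi v -> u = v) /\
    (forall e, 0 < e -> exists2 h, 0 < h &
      forall w, `|w - Phi z| < h -> exists2 u, `|u - z| < e & Phi u = w).
Proof.
move=> uK sd; have [c c0 cK] := mulmx_bounded (invmx K).
(* As c bounds the inverse of K, this linearization error makes T Lipschitz with constant 1/2. *)
have c2 : 0 < (2 * c)^-1 by rewrite invr_gt0 mulr_gt0.
have [d d0 dP] : exists2 d, 0 < d & forall u v, `|u - z| < d -> `|v - z| < d ->
    `|Phi u - Phi v - (u - v) *m K| <= (2 * c)^-1 * `|u - v|.
  pose P i (d : R) := 0 < d /\ forall u v, `|u - z| < d -> `|v - z| < d ->
    `|Phi u 0 i - Phi v 0 i - ((u - v) *m col i K) 0 0| <= (2 * c)^-1 * `|u - v|.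
  have /choice[f fP] : forall i, exists d, P i d.
    by move=> i; have [d d0 dP] := sd i _ c2; exists d.
  exists (\big[Num.min/1]_i f i).
    by elim/big_ind: _ => // [x y x0 y0|i _]; [rewrite lt_min x0 y0|case: (fP i)].
  move=> u v ud vd; apply: mx_norm_le => [|i j]; first by rewrite mulr_ge0 // ltW.
  rewrite !ord1; have [_ /(_ u v)] := fP j.
  have le : \big[Num.min/1]_i f i <= f j by exact: bigmin_le_cond.
  move=> /(_ (lt_le_trans ud le) (lt_le_trans vd le)).
  have -> : ((u - v) *m col j K) 0 0 = ((u - v) *m K) 0 j.
    by rewrite !mxE; apply: eq_bigr => k _; rewrite !mxE.
  by rewrite !(addmxE, oppmxE).
pose T w u := u - (Phi u - w) *m invmx K.
have TE w u : Phi u = w <-> u = T w u.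
  split => [<-|]; first by rewrite /T subrr mul0mx subr0.
  move/eqP; rewrite eq_sym /T subr_eq addrC -subr_eq subrr eq_sym => /eqP h.
  by apply/eqP; rewrite -subr_eq0 -[_ - _](mulmxKV uK) h mul0mx.
have Tlip w u v : `|u - z| < d -> `|v - z| < d ->
    `|T w u - T w v| <= 2^-1 * `|u - v|.
  move=> ud vd.
  have -> : T w u - T w v = - ((Phi u - Phi v - (u - v) *m K) *m invmx K).
    rewrite [in RHS]mulmxBl mulmxK // /T !mulmxBl.
    by apply/rowP => i; rewrite !mxE; ring.
  rewrite normrN (le_trans (cK _)) // -ler_pdivlMl // (le_trans (dP _ _ ud vd)) //.
  by rewrite mulrA invfM [c^-1 * _]mulrC lexx.
exists d => //; split=> [u v ud vd uv|e e0].
  have := Tlip (Phi v) u v ud vd.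
  have <- : u = T (Phi v) u by apply/TE.
  have <- : v = T (Phi v) v by apply/TE.
  have := normr_ge0 (u - v); move=> n0 n1; apply/eqP; rewrite -subr_eq0 -normr_le0; lra.
pose r := Num.min (e / 2) (d / 2).
have r0 : 0 < r by rewrite lt_min !divr_gt0.
have rd : r < d by rewrite gt_min; apply/orP; right; lra.
have re : r < e by rewrite gt_min; apply/orP; left; lra.
(* Then T w displaces z by at most r / 2, and the contraction contributes another r / 2, so the
   closed ball of radius r is mapped to itself. *)
exists (r / (2 * c)) => [|w wz]; first by rewrite divr_gt0 // mulr_gt0.
pose U : set 'rV[R]_n := [set u | `|u - z| <= r].
have TU : set_fun U U (T w).
  move=> u Uu; rewrite /U /=.
  have -> : T w u - z = (T w u - T w z) + (w - Phi z) *m invmx K.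
    by rewrite [T w z]/T !mulmxBl; apply/rowP => i; rewrite !mxE; ring.
  apply: le_trans (ler_normD _ _) _.
  have := Tlip w u z (le_lt_trans Uu rd); rewrite subrr normr0 => /(_ d0).
  have := cK (w - Phi z); have : c * `|w - Phi z| <= r / 2.
    rewrite -ler_pdivlMl // (le_trans (ltW wz)) // invfM.
    by rewrite le_eqVlt; apply/orP; left; apply/eqP; ring.
  have : `|u - z| <= r := Uu; move: `|u - z| `|T w u - T w z| `|w - Phi z|.
  move: `|_ *m invmx K| => a1 a2 a3 a4; lra.
have clU : closed U.
  rewrite (_ : U = closed_ball z r); first exact: closed_ball_closed.
  by rewrite closed_ballE //; apply/funext => u; rewrite /U /closed_ball_ /= distrC.
have [|||p Up pT] := @banach_fixed_point R 'rV[R]_n U (mkfun TU).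
- have half0 : (0 : R) <= 2^-1 by rewrite invr_ge0.
  exists (NngNum half0); split; first by rewrite /= invf_lt1 ?ltr1n.
  move=> [u v] /= [Uu Uv]; apply: Tlip; exact: le_lt_trans rd.
- by [].
- by exists z; rewrite /U /= subrr normr0 ltW.
- by exists p; [exact: le_lt_trans Up re|apply/TE].
Qed.

End strict_differentiability.

(** * Calculus rules for strict derivatives *)

Section strict_diff_algebra.
Context {R : realType}.
Implicit Types (n p : nat).

Lemma row_mul_bounded n (L : 'cV[R]_n) :
  exists2 c, 0 < c & forall w : 'rV[R]_n, `|(w *m L) 0 0| <= c * `|w|.
Proof.
have [c c0 h] := mulmx_bounded L; exists c => // w.
by rewrite (le_trans _ (h w)) // mx_entry_norm_le.
Qed.

Lemma strict_diff_lin n (L : 'cV[R]_n) x :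
  strict_diff (fun z => (z *m L) 0 0) x L.
Proof.
move=> e e0; exists 1 => // u v _ _; rewrite mulmxBl addmxE oppmxE.
by rewrite subrr normr0 mulr_ge0 // ltW.
Qed.

Lemma strict_diffD n (g h : 'rV[R]_n -> R) x L M :
  strict_diff g x L -> strict_diff h x M ->
  strict_diff (fun z => g z + h z) x (L + M).
Proof.
move=> sg sh e e0; have e2 : 0 < e / 2 by rewrite divr_gt0.
have [d1 d10 h1] := sg _ e2; have [d2 d20 h2] := sh _ e2.
exists (Num.min d1 d2) => [|u v]; first by rewrite lt_min d10.
rewrite !lt_min => /andP[u1 u2] /andP[v1 v2].
have {h1} := h1 _ _ u1 v1; have {h2} := h2 _ _ u2 v2.
rewrite mulmxDr addmxE.
move: ((u - v) *m L) ((u - v) *m M) `|u - v| => a b c hb ha.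
have -> : g u + h u - (g v + h v) - (a 0 0 + b 0 0) =
  (g u - g v - a 0 0) + (h u - h v - b 0 0) by ring.
apply: le_trans (ler_normD _ _) _.
rewrite (_ : e * c = e / 2 * c + e / 2 * c); last by field.
exact: lerD.
Qed.

Lemma strict_diffN n (g : 'rV[R]_n -> R) x L :
  strict_diff g x L -> strict_diff (fun z => - g z) x (- L).
Proof.
move=> sg e /sg[d d0 h]; exists d => // u v ux vx.
rewrite mulmxN oppmxE -[leLHS]normrN; apply: le_trans (h _ _ ux vx).
by rewrite le_eqVlt; apply/orP; left; apply/eqP; congr (`| _ |); ring.
Qed.

Lemma strict_diff_sum n (I : Type) (r : seq I) (g : I -> 'rV[R]_n -> R) x L :
  (forall i, strict_diff (g i) x (L i)) ->
  strict_diff (fun z => \sum_(i <- r) g i z) x (\sum_(i <- r) L i).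
Proof.
move=> sg; elim: r => [|i r IH].
  move=> e e0; exists 1 => // u v _ _; rewrite !big_nil mulmx0 mxE !subr0 normr0.
  by rewrite mulr_ge0 // ltW.
rewrite big_cons (_ : (fun z => _) = fun z => g i z + \sum_(j <- r) g j z).
  exact: strict_diffD.
by apply/funext => z; rewrite big_cons.
Qed.

Lemma strict_diff_lipschitz n (g : 'rV[R]_n -> R) x L : strict_diff g x L ->
  exists2 c, 0 < c & exists2 d, 0 < d & forall u v, `|u - x| < d ->
    `|v - x| < d -> `|g u - g v| <= c * `|u - v|.
Proof.
move=> sg; have [c c0 cL] := row_mul_bounded L; have [d d0 h] := sg _ ltr01.
exists (1 + c); first by rewrite addr_gt0.
exists d => // u v ux vx; have := h _ _ ux vx; have := cL (u - v).
move: ((u - v) *m L) => w; rewrite mulrDl => h1 h2.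
rewrite -[g u - g v](subrK (w 0 0)); apply: le_trans (ler_normD _ _) _.
exact: lerD.
Qed.

Lemma strict_diffM n (g h : 'rV[R]_n -> R) x L M :
  strict_diff g x L -> strict_diff h x M ->
  strict_diff (fun z => g z * h z) x (h x *: L + g x *: M).
Proof.
move=> sg sh e e0.
have [cg cg0 [dg dg0 lg]] := strict_diff_lipschitz sg.
have [ch ch0 [dh dh0 lh]] := strict_diff_lipschitz sh.
have [cL cL0 bL] := row_mul_bounded L; have [cM cM0 bM] := row_mul_bounded M.
(* B bounds the factors multiplying the two linearization errors; C times d bounds the cross terms,
   where a linear part meets the deviation of the other factor from its value at x. Each
   contribution is kept below e / 2. *)
pose B := `|h x| + ch + `|g x| + cg; pose C := cL * ch + cg * cM.
have B0 : 0 < B by rewrite ltr_wpDl // addr_ge0 // addr_ge0 // ltW.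
have C0 : 0 < C by rewrite addr_gt0 // mulr_gt0.
have [d1 d10 h1] := sg _ (divr_gt0 (divr_gt0 e0 (ltr0n R 2)) B0).
have [d2 d20 h2] := sh _ (divr_gt0 (divr_gt0 e0 (ltr0n R 2)) B0).
pose d3 := e / 2 / C; have d30 : 0 < d3 by rewrite !divr_gt0.
pose d := Num.min (Num.min (Num.min dg dh) (Num.min d1 d2)) (Num.min d3 1).
have [[ddg ddh] [dd1 dd2] [dd3 dd4]] :
    [/\ d <= dg /\ d <= dh, d <= d1 /\ d <= d2 & d <= d3 /\ d <= 1].
  by rewrite !ge_min !lexx !orbT.
exists d => [|u v ux vx]; first by rewrite !lt_min dg0 dh0 d10 d20 d30 ltr01.
have xx : `|x - x| < d.
  by rewrite subrr normr0 !lt_min dg0 dh0 d10 d20 d30 ltr01.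
have gv := lg v x (lt_le_trans vx ddg) (lt_le_trans xx ddg).
have hu := lh u x (lt_le_trans ux ddh) (lt_le_trans xx ddh).
have {}h1 := h1 _ _ (lt_le_trans ux dd1) (lt_le_trans vx dd1).
have {}h2 := h2 _ _ (lt_le_trans ux dd2) (lt_le_trans vx dd2).
have {}bL := bL (u - v); have {}bM := bM (u - v).
rewrite mulmxDr -!scalemxAr addmxE 2!scalemxE.
set a := ((u - v) *m L) 0 0 in h1 bL *; set b := ((u - v) *m M) 0 0 in h2 bM *.
set w := `|u - v| in h1 h2 bL bM *; have w0 : 0 <= w := normr_ge0 _.
have gvd : `|g v - g x| <= cg * d.
  by apply: le_trans gv _; rewrite ler_wpM2l // ltW.
have hud : `|h u - h x| <= ch * d.
  by apply: le_trans hu _; rewrite ler_wpM2l // ltW.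
have d0 : 0 <= d := ltW (le_lt_trans (normr_ge0 _) ux).
have gB : `|g v| <= `|g x| + cg.
  rewrite -[g v](subrK (g x)) addrC (le_trans (ler_normD _ _)) // lerD2l.
  by rewrite (le_trans gvd) // ler_piMr // ltW.
have hB : `|h u| <= `|h x| + ch.
  rewrite -[h u](subrK (h x)) addrC (le_trans (ler_normD _ _)) // lerD2l.
  by rewrite (le_trans hud) // ler_piMr // ltW.
have -> : g u * h u - g v * h v - (h x * a + g x * b) =
   (g u - g v - a) * h u + a * (h u - h x) + (h u - h v - b) * g v
   + (g v - g x) * b by ring.
have t1 : `|(g u - g v - a) * h u| <= e / 2 / B * w * (`|h x| + ch).
  by rewrite normrM ler_pM.
have t2 : `|a * (h u - h x)| <= cL * w * (ch * d) by rewrite normrM ler_pM.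
have t3 : `|(h u - h v - b) * g v| <= e / 2 / B * w * (`|g x| + cg).
  by rewrite normrM ler_pM.
have t4 : `|(g v - g x) * b| <= cg * d * (cM * w) by rewrite normrM ler_pM.
apply: le_trans (ler_normD _ _) _; apply: le_trans (lerD (ler_normD _ _) t4) _.
apply: le_trans (lerD (lerD (ler_normD _ _) t3) (lexx _)) _.
apply: le_trans (lerD (lerD (lerD t1 t2) (lexx _)) (lexx _)) _.
have -> : e / 2 / B * w * (`|h x| + ch) + cL * w * (ch * d) +
    e / 2 / B * w * (`|g x| + cg) + cg * d * (cM * w) =
    (e / 2 / B * B + d * C) * w by rewrite /B /C; ring.
rewrite divfK ?gt_eqF // ler_wpM2r // [e in leRHS](splitr e) lerD2l.
by rewrite -ler_pdivlMr.
Qed.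

Lemma strict_diff_lsub n p (g : 'rV[R]_n -> R) (x : 'rV[R]_n) (l : 'rV[R]_p) L :
  strict_diff g x L ->
  strict_diff (fun z : 'rV[R]_(n + p) => g (lsubmx z)) (row_mx x l) (col_mx L 0).
Proof.
have le (z : 'rV[R]_(n + p)) : `|lsubmx z| <= `|z|.
  by apply: mx_norm_le => // i j; rewrite mxE mx_entry_norm_le.
move=> sg e e0; have [d d0 h] := sg _ e0; exists d => // u v ux vx.
have sub (z : 'rV[R]_(n + p)) : `|z - row_mx x l| < d -> `|lsubmx z - x| < d.
  by apply: le_lt_trans; have := le (z - row_mx x l); rewrite linearB /= row_mxKl.
have := h _ _ (sub _ ux) (sub _ vx).
rewrite -[X in _ -> `|_ - (X *m _) 0 0| <= _]hsubmxK mul_row_col mulmx0 addr0.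
rewrite linearB /= => /le_trans; apply; rewrite ler_wpM2l ?(ltW e0) //.
by rewrite -linearB le.
Qed.

End strict_diff_algebra.

(** * Stability of the equality constrained KKT system *)

Section lagrangians.
Context {R : realType} {n p : nat}.
Implicit Types (f : 'rV[R]_n -> R) (G : 'I_p -> 'rV[R]_n -> R).

(** The constant c receives the terms with t in the Lagrange function of D(t); it changes neither
    gradient nor Hessian. *)
Definition lagr f G (l : 'rV[R]_p) (c : R) (y : 'rV[R]_n) : R :=
  f y - \sum_j l 0 j * G j y + c.

Definition jac G (x : 'rV[R]_n) : 'M[R]_(p, n) := \matrix_(j, i) partial (G j) i x.

Lemma lagrE f G l c : lagr f G l c = f - \sum_j (l 0 j *: G j) + cst c.
Proof. by apply/funext => y; rewrite /lagr !fctE fct_sumE. Qed.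

Lemma partial_lagr f G l c i :
    (forall x, differentiable f x) -> (forall j x, differentiable (G j) x) ->
  partial (lagr f G l c) i = lagr (partial f i) (fun j => partial (G j) i) l 0.
Proof.
move=> df dG; apply/funext => x; rewrite /partial lagrE /lagr.
have dfx : derivable f x (delta_mx 0 i) by exact: diff_derivable.
have dGx j : derivable (l 0 j *: G j) x (delta_mx 0 i).
  by apply: derivableZ; exact: diff_derivable.
have ds := derivable_sum dGx.
rewrite deriveD ?derive_cst; [|exact: derivableB|exact: derivable_cst].
rewrite deriveB // derive_sum //; congr (_ - _ + _).
by apply: eq_bigr => j _; apply: deriveZ; exact: diff_derivable.
Qed.

Lemma grad_lagr f G l c x :
    (forall x, differentiable f x) -> (forall j x, differentiable (G j) x) ->
  grad (lagr f G l c) x = grad f x - l *m jac G x.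
Proof.
move=> df dG; apply/rowP => i; rewrite mxE partial_lagr // /lagr addr0.
by rewrite addmxE oppmxE !mxE; congr (_ - _); apply: eq_bigr => j _; rewrite mxE.
Qed.

Lemma hess_lagr f G l c x : C2 f -> (forall j, C2 (G j)) ->
  hess (lagr f G l c) x = hess f x - \sum_j l 0 j *: hess (G j) x.
Proof.
move=> [[df _] C1f] C2G; apply/matrixP => i k; rewrite mxE.
rewrite partial_lagr //; last by move=> j; case: (C2G j) => -[].
rewrite partial_lagr; [|by case: (C1f k)|by move=> j; case: (C2G j) => _ /(_ k)[]].
rewrite /lagr addr0 addmxE oppmxE summxE !mxE; congr (_ - _).
by apply: eq_bigr => j _; rewrite !mxE.
Qed.

Lemma hess_lagr_sym f G l c x : C2 f -> (forall j, C2 (G j)) ->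
  (hess (lagr f G l c) x)^T = hess (lagr f G l c) x.
Proof.
move=> C2f C2G; rewrite hess_lagr // linearB linear_sum /= hess_sym //.
congr (_ - _); apply: eq_bigr => j _.
have := hess_sym x (C2G j); move: (hess (G j) x) (l 0 j) => H a HT.
by rewrite linearZ /= HT.
Qed.

End lagrangians.

(** * Active gradients, tangent spaces and the KKT map *)

Section kkt.
Context {R : realType} {n p : nat}.
Variables (f : 'rV[R]_n -> R) (G : 'I_p -> 'rV[R]_n -> R) (A : {set 'I_p}).
Hypotheses (C2f : C2 f) (C2G : forall j, C2 (G j)).
(* The inactive constraints are replaced by zero, so that jac G x has the     *)
(* active gradients as its only nonzero rows and no submatrix is needed.      *)
Hypothesis G0 : forall j, j \notin A -> G j = cst 0.

Local Notation J := (jac G).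

(** The projection onto the inactive coordinates. Added as a block, it compensates for the zero rows
    of the Jacobian and restores invertibility. *)
Definition inactive : 'M[R]_p := diag_mx (\row_j (j \notin A)%:R).
Local Notation N := inactive.

Let df x : differentiable f x. Proof. by case: C2f => -[]. Qed.
Let dG j x : differentiable (G j) x. Proof. by case: (C2G j) => -[]. Qed.

Lemma inactiveP (l : 'rV[R]_p) :
  l *m N = 0 <-> forall j, j \notin A -> l 0 j = 0.
Proof.
split=> [lN j jA|l0]; last first.
  apply/rowP => j; rewrite mul_mx_diag !mxE.
  by case: (boolP (j \in A)) => [_|/l0 ->]; rewrite ?mulr0 ?mul0r.
by move/rowP/(_ j): lN; rewrite mul_mx_diag !mxE jA mulr1.
Qed.

Lemma inactive_tr : N^T = N. Proof. by rewrite tr_diag_mx. Qed.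

Lemma inactive_idem : N *m N = N.
Proof.
rewrite mulmx_diag; congr diag_mx; apply/rowP => j; rewrite !mxE.
by case: (_ \notin _); rewrite ?mulr1 ?mulr0.
Qed.

Lemma inactive_jac x : N *m J x = 0.
Proof.
apply/matrixP => j i; rewrite mul_diag_mx !mxE.
case: (boolP (j \in A)) => [_|/G0 ->]; rewrite ?mul0r // /partial.
by rewrite derive_cst mulr0.
Qed.

Lemma jac_inactive x : (J x)^T *m N = 0.
Proof. by rewrite -inactive_tr -trmx_mul inactive_jac trmx0. Qed.

(* mu *m N = 0 says that mu vanishes off A, see inactiveP. *)
Definition indep x := forall mu : 'rV[R]_p, mu *m N = 0 -> mu *m J x = 0 -> mu = 0.

(** The Gram matrix of the active gradients, completed by the identity on the inactive coordinates;
    it is invertible exactly under LICQ ([indep_gram]). *)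
Definition gram x : 'M[R]_p := J x *m (J x)^T + N.

Lemma inactive_gram x : N *m gram x = N.
Proof. by rewrite mulmxDr mulmxA inactive_jac mul0mx add0r inactive_idem. Qed.

Lemma gram_inactive x : gram x *m N = N.
Proof. by rewrite mulmxDl -mulmxA jac_inactive mulmx0 add0r inactive_idem. Qed.

Lemma indep_gram x : indep x <-> gram x \in unitmx.
Proof.
split=> [ind|u mu muN muJ]; last first.
  by apply: (can_inj (mulmxK u)); rewrite mul0mx mulmxDr mulmxA muJ mul0mx muN addr0.
rewrite -row_free_unit -kermx_eq0; apply/rowV0P => mu /sub_kermxP muQ.
have muN : mu *m N = 0 by rewrite -(gram_inactive x) mulmxA muQ mul0mx.
apply: ind => //; apply: sqr_norm_row_eq0.
move: muQ; rewrite mulmxDr muN addr0 trmx_mul !mulmxA => ->.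
by rewrite mul0mx mxE.
Qed.

(** Under independence the left kernel of the Jacobian is the row space of N, so the rank is the
    same at all such points. *)
Lemma rank_jac x : indep x -> \rank (J x) = (p - \rank N)%N.
Proof.
move=> /indep_gram u; have : \rank (kermx (J x)) = \rank N.
  apply/eqmx_rank/andP; split; last by apply/sub_kermxP; exact: inactive_jac.
  have -> : kermx (J x) = kermx (J x) *m N.
    apply: (can_inj (mulmxK u)) => /=.
    rewrite -[_ *m N *m _]mulmxA inactive_gram mulmxDr mulmxA.
    by rewrite mulmx_ker mul0mx add0r.
  exact: submxMl.
by rewrite mxrank_ker => <-; rewrite subKn ?rank_leq_row.
Qed.

(* The rows of B projected orthogonally on the kernel of (J x)^T. *)
Definition moved_basis r (B : 'M[R]_(r, n)) x : 'M[R]_(r, n) :=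
  B - B *m (J x)^T *m invmx (gram x) *m J x.

(** The projection sends rows into the kernel at y, and both kernels have the same dimension by
    [rank_jac]; independent rows therefore span. *)
Lemma moved_basisP r (B : 'M[R]_(r, n)) x y : indep x -> indep y ->
    row_free B -> (B :=: kermx (J x)^T)%MS -> row_free (moved_basis B y) ->
  (moved_basis B y :=: kermx (J y)^T)%MS.
Proof.
move=> ix iy fB Bx fB'; apply/eqmxP/andP.
have uy : gram y \in unitmx by apply/indep_gram.
have sub : (moved_basis B y <= kermx (J y)^T)%MS.
  apply/sub_kermxP; rewrite mulmxBl -!mulmxA.
  have -> : J y *m (J y)^T = gram y - N by rewrite addrK.
  have -> : invmx (gram y) *m (gram y - N) = 1%:M - N.
    rewrite mulmxBr mulVmx //; congr (_ - _).
    by apply: (can_inj (mulKmx uy)); rewrite mulKVmx // gram_inactive.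
  by rewrite mulmxBr mulmx1 jac_inactive subr0 subrr.
have [_ <-] := mxrank_leqif_sup sub; split=> //.
move: fB fB'; rewrite /row_free => /eqP rB /eqP ->.
by rewrite -{1}rB Bx !mxrank_ker !mxrank_tr !rank_jac.
Qed.

Lemma moved_basis_id r (B : 'M[R]_(r, n)) x : (B <= kermx (J x)^T)%MS ->
  moved_basis B x = B.
Proof. by move/sub_kermxP => BJ; rewrite /moved_basis BJ !mul0mx subr0. Qed.

(** * Continuity of multipliers, tangent basis and Hessian near a solution *)

Variables (x0 : 'rV[R]_n) (l0 : 'rV[R]_p).
Hypotheses (feas0 : forall j, G j x0 = 0) (l0N : l0 *m N = 0).
Hypothesis stat0 : grad f x0 = l0 *m J x0.
Hypothesis indep0 : indep x0.

Local Notation H x l := (hess (lagr f G l 0) x).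

Lemma hess_lagr_cst l c x : hess (lagr f G l c) x = H x l.
Proof. by rewrite !hess_lagr. Qed.

Lemma cvg_jac j i : J x j i @[x --> x0] --> J x0 j i.
Proof.
rewrite mxE; under eq_cvg do rewrite mxE.
by have [[_ c] _] := C2G j; exact: c.
Qed.

Lemma cvg_gram i j : gram x i j @[x --> x0] --> gram x0 i j.
Proof.
rewrite addmxE; under eq_cvg do rewrite addmxE.
apply: (@cvgD _ _ _ _ (nbhs_filter x0)); last exact: cvg_cst.
apply: (@cvg_mulmx _ _ _ (nbhs_filter x0)); first exact: cvg_jac.
by move=> a b; rewrite mxE; under eq_cvg do rewrite mxE; exact: cvg_jac.
Qed.

Lemma cvg_invmx_gram i j : invmx (gram x) i j @[x --> x0] --> invmx (gram x0) i j.
Proof.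
apply: (@cvg_invmx _ _ _ (nbhs_filter x0)); first exact: cvg_gram.
exact/indep_gram.
Qed.

Lemma cvg_moved_basis r (B : 'M[R]_(r, n)) i j :
  moved_basis B x i j @[x --> x0] --> moved_basis B x0 i j.
Proof.
rewrite addmxE oppmxE; under eq_cvg do rewrite addmxE oppmxE.
apply: (@cvgB _ _ _ _ (nbhs_filter x0)); first exact: cvg_cst.
apply: (@cvg_mulmx _ _ _ (nbhs_filter x0)); last exact: cvg_jac.
apply: (@cvg_mulmx _ _ _ (nbhs_filter x0)); last exact: cvg_invmx_gram.
apply: (@cvg_mulmx _ _ _ (nbhs_filter x0)) => a b; first exact: cvg_cst.
by rewrite mxE; under eq_cvg do rewrite mxE; exact: cvg_jac.
Qed.

Lemma near_indep : \forall x \near x0, indep x.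
Proof.
have := near_unitmx (FF := nbhs_filter x0) cvg_gram (proj1 (indep_gram x0) indep0).
by apply: filterS => x /indep_gram.
Qed.

(* The multipliers at x are the least-squares solution grad f J^T gram^-1. *)
Lemma near_multipliers e : 0 < e -> \forall x \near x0,
  forall mu, mu *m N = 0 -> grad f x = mu *m J x -> `|mu - l0| < e.
Proof.
move=> e0; pose Lam x := grad f x *m (J x)^T *m invmx (gram x).
have LamE x mu : indep x -> mu *m N = 0 -> grad f x = mu *m J x -> Lam x = mu.
  move=> /indep_gram u muN st; apply: (can_inj (mulmxK u)) => /=.
  by rewrite /Lam mulmxKV // st mulmxDr muN addr0 mulmxA.
have cL j : Lam x 0 j @[x --> x0] --> Lam x0 0 j.
  apply: (@cvg_mulmx _ _ _ (nbhs_filter x0)); last exact: cvg_invmx_gram.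
  apply: (@cvg_mulmx _ _ _ (nbhs_filter x0)) => a b.
    rewrite mxE; under eq_cvg do rewrite mxE.
    by have [[_ c] _] := C2f; exact: c.
  by rewrite mxE; under eq_cvg do rewrite mxE; exact: cvg_jac.
have e2 : 0 < e / 2 by rewrite divr_gt0.
have : \forall x \near x0, forall j, `|Lam x0 0 j - Lam x 0 j| <= e / 2.
  apply: (@filter_forall _ _ _ (nbhs x0)) => j.
  by move/cvgrPdist_le: (cL j) => /(_ _ e2).
move: near_indep; apply: filterS2 => x ix Lx mu muN st.
rewrite (@le_lt_trans _ _ (e / 2)) ?gtr_pMr ?invf_lt1 ?ltr1n //.
apply: mx_norm_le => [|i j]; first exact: ltW.
by rewrite !ord1 addmxE oppmxE distrC -(LamE x0 l0) // -(LamE x mu).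
Qed.

Variables (r : nat) (B : 'M[R]_(r, n)).
Hypotheses (fB : row_free B) (kB : (B :=: kermx (J x0)^T)%MS).
Hypothesis nondeg0 :
  B *m H x0 l0 *m B^T *m invmx (B *m B^T) \in unitmx.

Lemma cvg_hess_lagr i k :
  H z.1 z.2 i k @[z --> filter_prod (nbhs x0) (nbhs l0)] --> H x0 l0 i k.
Proof.
have c1 (g : 'rV[R]_n -> R) : {for x0, continuous g} ->
    g z.1 @[z --> filter_prod (nbhs x0) (nbhs l0)] --> g x0.
  by move=> cg; apply: (@cvg_comp _ _ _ fst g _ (nbhs x0)) => //; exact: cvg_fst.
have hE x l : H x l i k = partial (partial f k) i x -
    \sum_j l 0 j * partial (partial (G j) k) i x.
  rewrite hess_lagr // addmxE oppmxE summxE mxE; congr (_ - _).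
  by apply: eq_bigr => j _; rewrite scalemxE mxE.
have -> : (fun z : 'rV[R]_n * 'rV[R]_p => H z.1 z.2 i k) =
    fun z => partial (partial f k) i z.1 -
      \sum_j z.2 0 j * partial (partial (G j) k) i z.1.
  by apply/funext => z; exact: hE.
rewrite [H x0 l0 i k]hE.
apply: cvgB; first by apply: c1; have [_ /(_ k)[_]] := C2f; apply.
apply: cvg_sumr => j _; apply: cvgM; last first.
  by apply: c1; have [_ /(_ k)[_]] := C2G j; apply.
apply: (cvg_comp snd (fun l : 'rV[R]_p => l 0 j)); first exact: cvg_snd.
exact: coord_continuous.
Qed.

(** In the projected basis the restricted Hessians at nearby pairs (x, l) have one fixed size and
    depend continuously on the pair, so [num_neg_stable] applies; [restrict_form_basis] carries the
    result to any T with the right row space. *)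
Lemma near_index : exists2 d, 0 < d & forall x l,
  `|x - x0| < d -> `|l - l0| < d ->
  forall T : 'M[R]_n, (T :=: kermx (J x)^T)%MS ->
    restrict_form (H x l) T \in unitmx /\
    num_neg_eigenvalues (restrict_form (H x l) T) =
    num_neg_eigenvalues (B *m H x0 l0 *m B^T *m invmx (B *m B^T)).
Proof.
have B0 : moved_basis B x0 = B by apply: moved_basis_id; rewrite kB.
pose F := filter_prod (nbhs x0) (nbhs l0).
have cB i j : moved_basis B z.1 i j @[z --> F] --> B i j.
  rewrite -{2}B0.
  apply: (cvg_comp fst (fun x => moved_basis B x i j)); first exact: cvg_fst.
  exact: cvg_moved_basis.
have cBT i j : (moved_basis B z.1)^T i j @[z --> F] --> B^T i j.
  by rewrite mxE; under eq_cvg do rewrite mxE; exact: cB.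
have cS i j : (moved_basis B z.1 *m H z.1 z.2 *m (moved_basis B z.1)^T) i j
    @[z --> F] --> (B *m H x0 l0 *m B^T) i j.
  by apply: cvg_mulmx => //; apply: cvg_mulmx => //; exact: cvg_hess_lagr.
(* The product with B^T tends to the invertible B B^T, so the projected rows keep full rank. *)
have freeB : \forall x \near x0, row_free (moved_basis B x).
  have uBB : B *m B^T \in unitmx by apply: posdef_unit; exact: posdef_gram.
  have cBB i j : (moved_basis B x *m B^T) i j @[x --> x0] --> (B *m B^T) i j.
    apply: (@cvg_mulmx _ _ _ (nbhs_filter x0)) => a b; last exact: cvg_cst.
    by rewrite -[in X in _ --> X a b]B0; exact: cvg_moved_basis.
  move: (near_unitmx (FF := nbhs_filter x0) cBB uBB); apply: filterS => x.
  rewrite -row_free_unit -!row_leq_rank => /leq_trans; apply.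
  exact: mxrankM_maxl.
have good : \forall z \near F, row_free (moved_basis B z.1) /\ indep z.1.
  exact: cvg_fst (filterI freeB near_indep).
have := num_neg_stable (S := fun z =>
    moved_basis B z.1 *m H z.1 z.2 *m (moved_basis B z.1)^T)
  (G := fun z => moved_basis B z.1 *m (moved_basis B z.1)^T) _ _ _
  (posdef_gram fB) nondeg0 _ cS.
have symS (x : 'rV[R]_n) (l : 'rV[R]_p) (C : 'M[R]_(r, n)) :
    (C *m H x l *m C^T)^T = C *m H x l *m C^T.
  by rewrite !trmx_mul trmxK hess_lagr_sym // mulmxA.
have symG (C : 'M[R]_(r, n)) : (C *m C^T)^T = C *m C^T.
  by rewrite trmx_mul trmxK.
case/(_ _ _ _ _)/(filterI good).
- exact: symS.
- exact: symG.
- move: good; apply: filterS => z [fz _]; split; [exact: symS|exact: symG|].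
  exact: posdef_gram.
move=> [P Q] /= [nP nQ] PQ.
have [d1 d10 P1] := (nbhs_rowP x0 P).1 nP.
have [d2 d20 Q2] := (nbhs_rowP l0 Q).1 nQ.
exists (Num.min d1 d2) => [|x l]; first by rewrite lt_min d10.
rewrite !lt_min => /andP[xd _] /andP[_ ld] T kT.
have [[fx ix] [u nn]] := PQ (x, l) (conj (P1 _ xd) (Q2 _ ld)).
have bT : (moved_basis B x :=: T)%MS.
  exact: eqmx_trans (moved_basisP indep0 ix fB kB fx) (eqmx_sym kT).
by have [-> ->] := restrict_form_basis (H x l) fx bT.
Qed.

(** The variable is the pair (x, l). The term with N adds the equations l_j = 0 for inactive j,
    which makes the system square. *)
Definition kkt_map (z : 'rV[R]_(n + p)) : 'rV[R]_(n + p) :=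
  row_mx (grad f (lsubmx z) - rsubmx z *m J (lsubmx z))
         (\row_j G j (lsubmx z) + rsubmx z *m N).

(** The derivative of [kkt_map] at (x0, l0), acting on rows: (v, mu) goes to (v H - mu J, v J^T + mu
    N). *)
Definition kkt_mx : 'M[R]_(n + p) :=
  block_mx (H x0 l0) (J x0)^T (- J x0) N.

Lemma kkt_map0 : kkt_map (row_mx x0 l0) = 0.
Proof.
rewrite /kkt_map row_mxKl row_mxKr stat0 subrr l0N addr0.
rewrite (_ : \row_j _ = 0) ?row_mx0 //.
by apply/rowP => j; rewrite !mxE feas0.
Qed.

(** For (v, mu) in the kernel, multiplying the second block by N gives mu N = 0, so v is tangent, v
    = c B. Multiplying v H = mu J by B^T gives c (B H B^T) = 0, hence c = 0 by nondegeneracy, and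
    then mu = 0 by independence. *)
Lemma kkt_mx_unit : kkt_mx \in unitmx.
Proof.
rewrite -row_free_unit -kermx_eq0; apply/rowV0P => z /sub_kermxP.
rewrite -[z]hsubmxK; move: (lsubmx z) (rsubmx z) => v mu.
rewrite mul_row_block -row_mx0 => /eq_row_mx[].
rewrite mulmxN => /eqP; rewrite subr_eq0 => /eqP vH vJ.
have muN : mu *m N = 0.
  have := congr1 (mulmx^~ N) vJ => /=.
  by rewrite mulmxDl -!mulmxA jac_inactive inactive_idem mulmx0 add0r mul0mx.
move: vJ; rewrite muN addr0 => vJ.
have /submxP[c vc] : (v <= B)%MS by rewrite kB; apply/sub_kermxP.
have JB : J x0 *m B^T = 0.
  apply: trmx_inj; rewrite trmx_mul trmxK trmx0; apply/sub_kermxP.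
  by rewrite -kB.
have uBB : B *m B^T \in unitmx by apply: posdef_unit; exact: posdef_gram.
have uS : B *m H x0 l0 *m B^T \in unitmx.
  by move: nondeg0; rewrite unitmx_mul unitmx_inv uBB andbT.
have c0 : c = 0.
  apply: (can_inj (mulmxK uS)) => /=.
  by rewrite mul0mx !mulmxA -vc vH -mulmxA JB mulmx0.
have v0 : v = 0 by rewrite vc c0 mul0mx.
by rewrite v0 (indep0 muN) ?row_mx0 // -vH v0 mul0mx.
Qed.

Lemma strict_diff_kkt_map i :
  strict_diff (fun z => kkt_map z 0 i) (row_mx x0 l0) (col i kkt_mx).
Proof.
case: (split_ordP i) => [a ->|b ->].
  (* The linear form z -> l_j, so that the terms l_j dG_j fall under the product rule. *)
  pose ej j : 'cV[R]_(n + p) := col_mx 0 (delta_mx j 0).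
  have -> : (fun z => kkt_map z 0 (lshift p a)) = fun z => partial f a (lsubmx z) +
      - \sum_j (z *m ej j) 0 0 * partial (G j) a (lsubmx z).
    apply/funext => z; rewrite /kkt_map row_mxEl addmxE oppmxE !mxE.
    congr (_ - _); apply: eq_bigr => j _; rewrite [J _ _ _]mxE; congr (_ * _).
    by rewrite -[z in RHS]hsubmxK mul_row_col mulmx0 add0r -colE !mxE.
  have -> : col (lshift p a) kkt_mx = col_mx (grad (partial f a) x0)^T 0 +
      - \sum_j (partial (G j) a x0 *: ej j +
                l0 0 j *: col_mx (grad (partial (G j) a) x0)^T 0).
    apply/matrixP => c d; rewrite ord1 addmxE oppmxE summxE mxE.
    case: (split_ordP c) => [e ->|e ->].
      rewrite block_mxEul hess_lagr // addmxE oppmxE summxE col_mxEu !mxE.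
      congr (_ - _); apply: eq_bigr => j _.
      by rewrite addmxE !scalemxE !col_mxEu !mxE mulr0 add0r.
    rewrite block_mxEdl col_mxEd oppmxE [X in _ = X - _]mxE add0r; congr (- _).
    rewrite (bigD1 e) //= big1 ?addr0 => [|j je].
      by rewrite addmxE !scalemxE !col_mxEd !mxE !eqxx mulr1 mulr0 addr0.
    by rewrite addmxE !scalemxE !col_mxEd !mxE eq_sym (negPf je) !mulr0 addr0.
  apply: strict_diffD.
    by apply: strict_diff_lsub; apply: C1_strict_diff; case: C2f.
  apply: strict_diffN; apply: strict_diff_sum => j.
  have := @strict_diffM _ _ (fun z => (z *m ej j) 0 0)
    (fun z => partial (G j) a (lsubmx z)) (row_mx x0 l0) (ej j)
    (col_mx (grad (partial (G j) a) x0)^T 0).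
  rewrite row_mxKl mul_row_col mulmx0 add0r -colE [col _ _ _ _]mxE.
  apply; first exact: strict_diff_lin.
  by apply: strict_diff_lsub; apply: C1_strict_diff; case: (C2G j).
have -> : (fun z => kkt_map z 0 (rshift n b)) = fun z => G b (lsubmx z) +
    (z *m col_mx 0 (col b N)) 0 0.
  apply/funext => z; rewrite /kkt_map row_mxEr addmxE mxE; congr (_ + _).
  rewrite -[z in RHS]hsubmxK mul_row_col mulmx0 add0r !mxE.
  by apply: eq_bigr => j _; rewrite !mxE.
have -> : col (rshift n b) kkt_mx =
    col_mx (grad (G b) x0)^T 0 + col_mx 0 (col b N).
  rewrite add_col_mx addr0 add0r; apply/matrixP => c d; rewrite ord1 mxE.
  case: (split_ordP c) => [e ->|e ->]; first by rewrite block_mxEur col_mxEu !mxE.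
  by rewrite block_mxEdr col_mxEd !mxE.
apply: strict_diffD; last exact: strict_diff_lin.
by apply: strict_diff_lsub; apply: C1_strict_diff; case: (C2G b).
Qed.

(** Local inversion of [kkt_map] at the target (0, t s). Uniqueness assumes closeness of the point y
    only: [near_multipliers] then brings its multipliers into the ball where the map is
    injective. *)
Theorem kkt_path : exists2 d, 0 < d & forall e, 0 < e < d ->
  forall s : 'rV[R]_p, s *m N = 0 -> \forall t \near 0^'+, exists x l,
  [/\ [/\ `|x - x0| < e, `|l - l0| < e & l *m N = 0],
      grad f x = l *m J x /\ (forall j, G j x = t * s 0 j),
      indep x,
      (forall T : 'M[R]_n, (T :=: kermx (J x)^T)%MS ->
         restrict_form (H x l) T \in unitmx /\
         num_neg_eigenvalues (restrict_form (H x l) T) =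
         num_neg_eigenvalues (B *m H x0 l0 *m B^T *m invmx (B *m B^T))) &
      forall y mu, `|y - x0| < e -> mu *m N = 0 -> grad f y = mu *m J y ->
        (forall j, G j y = t * s 0 j) -> y = x].
Proof.
have [d1 d10 [inj sol]] := strict_diff_local_inverse kkt_mx_unit strict_diff_kkt_map.
have [d2 d20 ind] := near_index.
have [d3 d30 mul] := (nbhs_rowP _ _).1 (near_multipliers d10).
have [d4 d40 li] := (nbhs_rowP _ _).1 near_indep.
pose d := Num.min (Num.min d1 d2) (Num.min d3 d4).
have [[dd1 dd2] [dd3 dd4]] : (d <= d1 /\ d <= d2) /\ (d <= d3 /\ d <= d4).
  by rewrite !ge_min !lexx !orbT.
exists d => [|e /andP[e0 ed] s sN]; first by rewrite !lt_min d10 d20 d30.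
have [h h0 hP] := sol e e0; rewrite kkt_map0 in hP.
(* The + 1 allows s = 0. *)
have : \forall t \near 0^'+, 0 < t < h / (`|s| + 1).
  near=> t; apply/andP; split; near: t; first exact: nbhs_right_gt.
  by apply: nbhs_right_lt; rewrite divr_gt0 // ltr_wpDl.
apply: filterS => t /andP[t0]; rewrite ltr_pdivlMr ?ltr_wpDl // => th.
have {}th : t * `|s| < h.
  by apply: le_lt_trans th; rewrite ler_wpM2l ?(ltW t0) // lerDl.
have [|z ze zw] := hP (row_mx 0 (t *: s)).
  by rewrite subr0 norm_row_mx normr0 normrZ gtr0_norm // gt_max h0.
have sE (x : 'rV[R]_n) (l : 'rV[R]_p) : l *m N = 0 -> grad f x = l *m J x ->
    (forall j, G j x = t * s 0 j) -> kkt_map (row_mx x l) = row_mx 0 (t *: s).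
  move=> lN st Gs; rewrite /kkt_map row_mxKl row_mxKr st subrr lN addr0.
  by congr row_mx; apply/rowP => j; rewrite !mxE Gs.
have dist (x : 'rV[R]_n) (l : 'rV[R]_p) c :
    (`|row_mx x l - row_mx x0 l0| < c) = (`|x - x0| < c) && (`|l - l0| < c).
  by rewrite opp_row_mx add_row_mx norm_row_mx gt_max.
move: ze zw; rewrite -[z]hsubmxK; move: (lsubmx z) (rsubmx z) => x l.
rewrite dist => /andP[xe le].
rewrite /kkt_map row_mxKl row_mxKr => /eq_row_mx[/eqP]; rewrite subr_eq0.
move=> /eqP st Gs.
(* Multiplication by N isolates the inactive equations, in which both G and s vanish. *)
have lN : l *m N = 0.
  have := congr1 (mulmx^~ N) Gs => /=.
  rewrite mulmxDl -mulmxA inactive_idem -scalemxAl sN scaler0.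
  rewrite (_ : \row_j G j x *m N = 0) ?add0r //.
  by apply/inactiveP => j jA; rewrite mxE G0.
have Gx j : G j x = t * s 0 j.
  by move/rowP/(_ j): Gs; rewrite lN addr0 !mxE.
have up c c' : c < e -> d <= c' -> c < c'.
  by move=> ce dc; rewrite (lt_le_trans ce) // (le_trans (ltW ed)).
exists x, l; split => //.
- by apply: li; exact: up xe dd4.
- by apply: ind; [exact: up xe dd2|exact: up le dd2].
- move=> y mu ye muN sty Gy.
  have mu1 : `|mu - l0| < d1 by apply: (mul y) => //; exact: up ye dd3.
  have : row_mx y mu = row_mx x l.
    apply: inj; rewrite ?dist ?mu1 ?(up _ _ ye dd1) ?(up _ _ xe dd1)
      ?(up _ _ le dd1) //.
    by rewrite !sE.
  by case/eq_row_mx.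
Unshelve. all: by end_near. Qed.

End kkt.

(** * From C-stationarity of the regularization to the KKT system *)

Lemma free_mapP (K : fieldType) (vT : vectType K) (I : eqType) (v : I -> vT)
    (s : seq I) : uniq s ->
  free [seq v j | j <- s] <->
  (forall c : I -> K, \sum_(j <- s) c j *: v j = 0 -> forall j, j \in s -> c j = 0).
Proof.
move=> us; pose X := map_tuple v (in_tuple s).
have XE (i : 'I_(size s)) : X`_i = v (tnth (in_tuple s) i).
  by rewrite -tnth_nth tnth_map.
split=> [/(@freeP _ _ _ X) fX c c0 j js | h].
  have ji : (index j s < size s)%N by rewrite index_mem.
  have /(_ _ (Ordinal ji)) := fX (fun i => c (tnth (in_tuple s) i)).
  rewrite (tnth_nth j) /= nth_index //; apply.
  by rewrite -[RHS]c0 [RHS]big_tnth; apply: eq_bigr => i _; rewrite XE.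
apply/(@freeP _ _ _ X) => c c0 i.
(* Coefficients given by position become a function of the index; the default 0 is only taken
   outside s. *)
pose c' j := if insub (index j s) is Some i then c i else 0.
have cE l : c' (tnth (in_tuple s) l) = c l.
  rewrite /c' (tnth_nth (tnth (in_tuple s) l)) index_uniq //.
  by rewrite insubT //= => lt; congr c; exact: val_inj.
rewrite -cE; apply: h; last by rewrite mem_tnth.
by rewrite -[RHS]c0 [LHS]big_tnth; apply: eq_bigr => l _; rewrite cE XE.
Qed.

(** * The two constraint families as one indexed family *)

Section joined_constraints.
Context {R : realType} {n k : nat}.
Variables (F1 F2 : 'rV[R]_n -> 'rV[R]_k).

Definition joined_active (A1 A2 : {set 'I_k}) : {set 'I_(k + k)} :=
  [set j | match fintype.split j with inl a => a \in A1 | inr b => b \in A2 end]%SET.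

(** The left half of the indices stands for F1 and the right half for F2, so that multiplier vectors
    are pairs [row_mx u v] of fixed size. *)
Definition joined (A1 A2 : {set 'I_k}) (j : 'I_(k + k)) : 'rV[R]_n -> R :=
  match fintype.split j with
  | inl a => if a \in A1 then coord_fun F1 a else cst 0
  | inr b => if b \in A2 then coord_fun F2 b else cst 0
  end.

Lemma joined_activeE (A1 A2 : {set 'I_k}) :
  ((forall a, (lshift k a \in joined_active A1 A2) = (a \in A1)) *
   (forall a, (rshift k a \in joined_active A1 A2) = (a \in A2)))%type.
Proof.
split=> a; rewrite inE.
  by rewrite (unsplitK (inl a : 'I_k + 'I_k)).
by rewrite (unsplitK (inr a : 'I_k + 'I_k)).
Qed.

Lemma joinedl (A1 A2 : {set 'I_k}) a :
  joined A1 A2 (lshift k a) = if a \in A1 then coord_fun F1 a else cst 0.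
Proof. by rewrite /joined (unsplitK (inl a : 'I_k + 'I_k)). Qed.

Lemma joinedr (A1 A2 : {set 'I_k}) a :
  joined A1 A2 (rshift k a) = if a \in A2 then coord_fun F2 a else cst 0.
Proof. by rewrite /joined (unsplitK (inr a : 'I_k + 'I_k)). Qed.

Lemma joined_inactive (A1 A2 : {set 'I_k}) j :
  j \notin joined_active A1 A2 -> joined A1 A2 j = cst 0.
Proof.
case: (split_ordP j) => a ->; rewrite joined_activeE ?joinedl ?joinedr.
  by move/negPf => ->.
by move/negPf => ->.
Qed.

Lemma C2_cst0 : C2 (cst 0 : 'rV[R]_n -> R).
Proof.
have p0 i : partial (cst 0 : 'rV[R]_n -> R) i = cst 0.
  by apply/funext => x; rewrite /partial derive_cst.
have C10 : C1 (cst 0 : 'rV[R]_n -> R).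
  split=> [x|i]; first exact: differentiable_cst.
  by rewrite p0; exact: cst_continuous.
by split=> // i; rewrite p0.
Qed.

Lemma C2_joined (A1 A2 : {set 'I_k}) j : vC2 F1 -> vC2 F2 -> C2 (joined A1 A2 j).
Proof.
move=> C1 C2; case: (split_ordP j) => a ->; rewrite ?joinedl ?joinedr.
  by case: ifP => _; [exact: C1|exact: C2_cst0].
by case: ifP => _; [exact: C2|exact: C2_cst0].
Qed.

(** The list of gradients enumerates the active rows of the joined Jacobian, and a combination
    supported on the active set only sees these rows. *)
Lemma licqP (A1 A2 : {set 'I_k}) x : licq F1 F2 A1 A2 x <->
  indep (joined A1 A2) (joined_active A1 A2) x.
Proof.
set G := joined _ _; set A := joined_active _ _.
pose v j := row j (jac G x).
pose s := map (lshift k) (enum A1) ++ map (@rshift k k) (enum A2).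
have us : uniq s.
  rewrite cat_uniq !map_inj_uniq ?enum_uniq ?andbT /=; last 2 first.
  - exact: rshift_inj.
  - exact: lshift_inj.
  apply/hasPn => _ /mapP[a _ ->]; apply/mapP => -[b _ /eqP].
  by rewrite eq_rlshift.
have sA j : (j \in s) = (j \in A).
  rewrite mem_cat; case: (split_ordP j) => a ->; rewrite joined_activeE.
    rewrite mem_map ?mem_enum; last exact: lshift_inj.
    case: (_ \in A1) => //=; apply/mapP => -[b _ /eqP].
    by rewrite eq_lrshift.
  rewrite [X in _ || X]mem_map ?mem_enum; last exact: rshift_inj.
  case: (_ \in A2); rewrite ?orbT ?orbF //; apply/mapP => -[b _ /eqP].
  by rewrite eq_rlshift.
have -> : licq F1 F2 A1 A2 x = free [seq v j | j <- s].
  rewrite /licq map_cat -!map_comp; congr (free (_ ++ _)).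
    apply/eq_in_map => a; rewrite mem_enum => aA; apply/rowP => i.
    by rewrite !mxE /G joinedl aA.
  apply/eq_in_map => a; rewrite mem_enum => aA; apply/rowP => i.
  by rewrite !mxE /G joinedr aA.
have sumE (mu : 'rV[R]_(k + k)) : mu *m inactive A = 0 ->
    mu *m jac G x = \sum_(j <- s) mu 0 j *: v j.
  move=> /inactiveP mu0; rewrite mulmx_sum_row (bigID (mem A)) /=.
  rewrite [X in _ + X]big1 ?addr0 => [|j jA]; last by rewrite mu0 // scale0r.
  by rewrite [RHS](big_uniq _ us) /=; apply: eq_bigl => j; rewrite sA.
rewrite (free_mapP _ us); split=> [h mu muN muJ|h c c0 j js].
  apply/rowP => j; rewrite mxE; have [jA|jA] := boolP (j \in A); last first.
    by move/inactiveP: muN; apply.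
  by apply: (h (fun j => mu 0 j)); rewrite -?sumE ?sA.
pose mu := \row_j (if j \in A then c j else 0).
have muN : mu *m inactive A = 0.
  by apply/inactiveP => i /negPf iA; rewrite mxE iA.
have /rowP/(_ j) : mu = 0.
  apply: h => //; rewrite sumE // -[RHS]c0; apply: eq_big_seq => i.
  by rewrite sA => iA; rewrite mxE iA.
by rewrite !mxE -sA js.
Qed.

Lemma tangentE (A1 A2 : {set 'I_k}) x :
  (tangent F1 F2 A1 A2 x :=: kermx (jac (joined A1 A2) x)^T)%MS.
Proof.
set G := joined _ _.
have rl a i : a \in A1 -> jac G x (lshift k a) i = grad (coord_fun F1 a) x 0 i.
  by move=> aA; rewrite !mxE /G joinedl aA.
have rr a i : a \in A2 -> jac G x (rshift k a) i = grad (coord_fun F2 a) x 0 i.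
  by move=> aA; rewrite !mxE /G joinedr aA.
have mE (u : 'rV[R]_n) (g : 'rV[R]_n) : u *m g^T = 0 <-> \sum_i u 0 i * g 0 i = 0.
  split=> [/matrixP/(_ 0 0)|h].
    rewrite mxE [X in _ = X -> _]mxE => h; rewrite -[RHS]h.
    by apply: eq_bigr => i _; rewrite mxE.
  apply/matrixP => a b; rewrite !ord1 !mxE -[RHS]h.
  by apply: eq_bigr => i _; rewrite mxE.
apply/eqmxP/andP; split; apply/rV_subP => u.
  rewrite sub_capmx => /andP[/sub_bigcapmxP u1 /sub_bigcapmxP u2].
  apply/sub_kermxP/rowP => j; rewrite !mxE.
  case: (split_ordP j) => a ->.
    have [aA|aA] := boolP (a \in A1).
      have /sub_kermxP/mE e := u1 _ aA; rewrite -[RHS]e.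
      by apply: eq_bigr => i _; rewrite mxE rl.
    rewrite big1 // => i _; rewrite !mxE /G joinedl (negPf aA).
    by rewrite /partial derive_cst mulr0.
  have [aA|aA] := boolP (a \in A2).
    have /sub_kermxP/mE e := u2 _ aA; rewrite -[RHS]e.
    by apply: eq_bigr => i _; rewrite mxE rr.
  rewrite big1 // => i _; rewrite !mxE /G joinedr (negPf aA).
  by rewrite /partial derive_cst mulr0.
move=> /sub_kermxP uJ; rewrite sub_capmx; apply/andP; split.
  apply/sub_bigcapmxP => a aA; apply/sub_kermxP/mE.
  move/rowP/(_ (lshift k a)): uJ; rewrite !mxE => h; rewrite -[RHS]h.
  by apply: eq_bigr => i _; rewrite [X in _ = _ * X]mxE rl.
apply/sub_bigcapmxP => a aA; apply/sub_kermxP/mE.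
move/rowP/(_ (rshift k a)): uJ; rewrite !mxE => h; rewrite -[RHS]h.
by apply: eq_bigr => i _; rewrite [X in _ = _ * X]mxE rr.
Qed.

Lemma lagr_joined f (A1 A2 : {set 'I_k}) (u v : 'rV[R]_k) c y :
    (forall a, a \notin A1 -> u 0 a = 0) -> (forall a, a \notin A2 -> v 0 a = 0) ->
  lagr f (joined A1 A2) (row_mx u v) c y =
  f y - \sum_a u 0 a * F1 y 0 a - \sum_a v 0 a * F2 y 0 a + c.
Proof.
move=> u0 v0; rewrite /lagr big_split_ord /= opprD addrA.
congr (_ - _ - _ + _); apply: eq_bigr => a _.
  rewrite row_mxEl joinedl; case: (boolP (a \in A1)) => // /u0 ->.
  by rewrite !mul0r.
rewrite row_mxEr joinedr; case: (boolP (a \in A2)) => // /v0 ->.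
by rewrite !mul0r.
Qed.

Lemma sum_setE (S : {set 'I_k}) (g : 'I_k -> R) :
  \sum_(a in S) g a = \sum_a (a \in S)%:R * g a.
Proof.
rewrite big_mkcond; apply: eq_bigr => a _.
by case: (a \in S); rewrite ?mul1r ?mul0r.
Qed.

Lemma mpcc_lagrangianE f x m (A1 A2 : {set 'I_k}) :
    A1 = (a01 F1 F2 x :|: a00 F1 F2 x)%SET ->
    A2 = (a10 F1 F2 x :|: a00 F1 F2 x)%SET ->
  let u := \row_a ((a \in a01 F1 F2 x)%:R * sigma1 m a +
                   (a \in a00 F1 F2 x)%:R * rho1 m a) in
  let v := \row_a ((a \in a10 F1 F2 x)%:R * sigma2 m a +
                   (a \in a00 F1 F2 x)%:R * rho2 m a) in
  mpcc_lagrangian f F1 F2 x m = lagr f (joined A1 A2) (row_mx u v) 0.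
Proof.
move=> -> -> u v; apply/funext => y; rewrite lagr_joined; last 2 first.
- move=> a; rewrite !inE negb_or => /andP[/negPf h1 /negPf h2].
  by rewrite mxE !inE h1 h2 !mul0r addr0.
- move=> a; rewrite !inE negb_or => /andP[/negPf h1 /negPf h2].
  by rewrite mxE !inE h1 h2 !mul0r addr0.
rewrite /mpcc_lagrangian !sum_setE addr0 -!addrA; congr (_ + _).
rewrite -!sumrN -!big_split /=; apply: eq_bigr => a _.
by rewrite !mxE; ring.
Qed.

(** A bound F = t enters as t - F, so its multiplier counts negatively for F and leaves a constant
    that is collected in c. *)
Lemma disj_lagrangianE f t x m (A1 A2 : {set 'I_k}) :
  let u := \row_a ((a \in N1 F1 x)%:R * nu1 m a -
    (a \in H12 F1 F2 t x)%:R * zeta1 m a - (a \in H1 F1 F2 t x)%:R * eta1 m a) in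
  let v := \row_a ((a \in N2 F2 x)%:R * nu2 m a -
    (a \in H12 F1 F2 t x)%:R * zeta2 m a - (a \in H2 F1 F2 t x)%:R * eta2 m a) in
    (forall a, a \notin A1 -> u 0 a = 0) -> (forall a, a \notin A2 -> v 0 a = 0) ->
  exists c, disj_lagrangian f F1 F2 t x m = lagr f (joined A1 A2) (row_mx u v) c.
Proof.
move=> u v u0 v0; pose c := - \sum_a t *
  ((a \in H12 F1 F2 t x)%:R * (zeta1 m a + zeta2 m a) +
   (a \in H1 F1 F2 t x)%:R * eta1 m a + (a \in H2 F1 F2 t x)%:R * eta2 m a).
exists c; apply/funext => y; rewrite lagr_joined //.
rewrite /disj_lagrangian !sum_setE /c -!addrA; congr (_ + _).
rewrite -!sumrN -!big_split /=; apply: eq_bigr => a _.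
by rewrite !mxE; ring.
Qed.

End joined_constraints.

(** * Multipliers and active sets of D(t) near the reference point *)

Section regularization.
Context {R : realType} {n k : nat}.
Variables (f : 'rV[R]_n -> R) (F1 F2 : 'rV[R]_n -> 'rV[R]_k).
Hypotheses (hf : C2 f) (hF1 : vC2 F1) (hF2 : vC2 F2).
Variables (x0 : 'rV[R]_n) (m : mpcc_mult R k).
Hypotheses (hnd : mpcc_nondegenerate_with f F1 F2 x0 m) (hnd4 : mpcc_ND4 F1 F2 x0 m).

Definition active1 : {set 'I_k} := (a01 F1 F2 x0 :|: a00 F1 F2 x0)%SET.
Definition active2 : {set 'I_k} := (a10 F1 F2 x0 :|: a00 F1 F2 x0)%SET.

Local Notation G := (joined F1 F2 active1 active2).
Local Notation A := (joined_active active1 active2).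

Definition mult1 : 'rV[R]_k := \row_a ((a \in a01 F1 F2 x0)%:R * sigma1 m a +
  (a \in a00 F1 F2 x0)%:R * rho1 m a).
Definition mult2 : 'rV[R]_k := \row_a ((a \in a10 F1 F2 x0)%:R * sigma2 m a +
  (a \in a00 F1 F2 x0)%:R * rho2 m a).

Local Notation l0 := (row_mx mult1 mult2).

Variant index_spec a : bool -> bool -> bool -> Prop :=
| Index01 of F1 x0 0 a = 0 & 0 < F2 x0 0 a : index_spec a true false false
| Index10 of 0 < F1 x0 0 a & F2 x0 0 a = 0 : index_spec a false true false
| Index00 of F1 x0 0 a = 0 & F2 x0 0 a = 0 : index_spec a false false true.

Lemma indexP a :
  index_spec a (a \in a01 F1 F2 x0) (a \in a10 F1 F2 x0) (a \in a00 F1 F2 x0).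
Proof.
have [[/(_ a)[FF F1a F2a] _ _] _ _ _] := hnd; rewrite !inE.
have [e1|n1] := eqVneq (F1 x0 0 a) 0.
  have [e2|n2] := eqVneq (F2 x0 0 a) 0.
    by rewrite e1 e2 ltxx /=; exact: Index00.
  have p2 : 0 < F2 x0 0 a by rewrite lt_def n2.
  by rewrite p2 e1 ltxx /=; exact: Index01.
have p1 : 0 < F1 x0 0 a by rewrite lt_def n1.
move/eqP: FF; rewrite mulf_eq0 (negPf n1) /= => e2.
by rewrite p1 e2 /=; apply: Index10 => //; exact/eqP.
Qed.

(** ND4 covers the indices in [a01] and [a10], ND2 the biactive ones. *)
Lemma mult_neq0 : (forall a, a \in active1 -> mult1 0 a != 0) /\
  (forall a, a \in active2 -> mult2 0 a != 0).
Proof.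
have [_ _ nd2 _] := hnd; have [s1 s2] := hnd4.
split=> a; rewrite inE mxE.
  case: (indexP a) (s1 a) (nd2 a) => _ _ // h1 h2 _.
    by rewrite mul1r mul0r addr0 h1.
  rewrite mul1r mul0r add0r; have := h2 isT; apply: contraTneq => ->.
  by rewrite mul0r ltxx.
case: (indexP a) (s2 a) (nd2 a) => _ _ // h1 h2 _.
  by rewrite mul1r mul0r addr0 h1.
rewrite mul1r mul0r add0r; have := h2 isT; apply: contraTneq => ->.
by rewrite mulr0 ltxx.
Qed.

Lemma mult_inactive : l0 *m inactive A = 0.
Proof.
apply/inactiveP => j; case: (split_ordP j) => a ->; rewrite joined_activeE.
  by rewrite row_mxEl mxE !inE negb_or => /andP[/negPf -> /negPf ->];
      rewrite !mul0r addr0.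
by rewrite row_mxEr mxE !inE negb_or => /andP[/negPf -> /negPf ->];
    rewrite !mul0r addr0.
Qed.

(** The equal signs come from the positive product in ND2; they send both components of a biactive
    index to the same level, 0 or t. *)
Lemma mult_a00 a : a \in a00 F1 F2 x0 ->
  [/\ mult1 0 a = rho1 m a, mult2 0 a = rho2 m a & (rho1 m a < 0) = (rho2 m a < 0)].
Proof.
have [_ _ nd2 _] := hnd; rewrite !mxE.
case: (indexP a) (nd2 a) => _ _ // /(_ isT) pos _; rewrite !mul0r !mul1r !add0r.
split=> //; case: (ltP (rho1 m a) 0) => h; first by move: pos; rewrite nmulr_rgt0.
apply/esym/negbTE; rewrite -leNgt leNgt; apply: contraTN pos => h2.
by rewrite -leNgt mulr_ge0_le0 // ltW.
Qed.

(* Constraints with a negative multiplier move to the level t, the others     *)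
(* stay at the level 0.                                                       *)
Definition shift : 'rV[R]_(k + k) := \row_j (l0 0 j < 0)%R%:R.

Lemma shift_inactive : shift *m inactive A = 0.
Proof.
apply/inactiveP => j jA; rewrite mxE.
by move/inactiveP: mult_inactive => ->; rewrite ?ltxx.
Qed.

(** The components positive at x0 exceed t at y, so neither bound is active for them. *)
Definition separated t y := [/\ 0 < t, forall a, a \in a01 F1 F2 x0 -> t < F2 y 0 a
  & forall a, a \in a10 F1 F2 x0 -> t < F1 y 0 a].

Lemma near_separated : exists2 c, 0 < c & \forall y \near x0,
  forall t, 0 < t < c -> separated t y.
Proof.
(* The positive component of index a at x0; a biactive index has none and gets the harmless value
   1. *)
pose w a := if a \in a01 F1 F2 x0 then F2 x0 0 a else
  if a \in a10 F1 F2 x0 then F1 x0 0 a else 1.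
have w0 a : 0 < w a by rewrite /w; case: indexP.
pose c := \big[Num.min/1]_a (w a / 2).
have c0 : 0 < c.
  by rewrite /c; elim/big_ind: _ => // [x y x1 y1|a _];
    [rewrite lt_min x1 y1|rewrite divr_gt0].
have cw a : c < w a.
  have le : c <= w a / 2 by exact: bigmin_le_cond.
  by apply: le_lt_trans le _; rewrite ltr_pdivrMr // ltr_pMr // ltr1n.
have cont (F : 'rV[R]_n -> 'rV[R]_k) a : vC2 F -> c < F x0 0 a ->
    \forall y \near x0, c < F y 0 a.
  move=> /(_ a)[[dF _] _]; have := differentiable_continuous (dF x0).
  move=> cF cFx; have /cvgr_gt := cF; exact.
exists c => //.
have : \forall y \near x0, forall a, (a \in a01 F1 F2 x0 -> c < F2 y 0 a) /\
    (a \in a10 F1 F2 x0 -> c < F1 y 0 a).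
  apply: (@filter_forall _ _ _ (nbhs x0)) => a; have := cw a; rewrite /w.
  case: indexP => // _ _ ca; [have := cont F2 a hF2 ca|have := cont F1 a hF1 ca|].
  - by apply: filterS => y.
  - by apply: filterS => y.
  - exact: nearW.
apply: filterS => y h t /andP[t0 tc].
by split=> // a aA; rewrite (lt_trans tc) //; apply h.
Qed.

(** The signed multiplier of F1: the coefficient of its gradient in the stationarity equation. *)
Definition disj_mult1 t y (mt : disj_mult R k) : 'rV[R]_k :=
  \row_a ((a \in N1 F1 y)%:R * nu1 mt a -
    (a \in H12 F1 F2 t y)%:R * zeta1 mt a - (a \in H1 F1 F2 t y)%:R * eta1 mt a).
Definition disj_mult2 t y (mt : disj_mult R k) : 'rV[R]_k :=
  \row_a ((a \in N2 F2 y)%:R * nu2 mt a -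
    (a \in H12 F1 F2 t y)%:R * zeta2 mt a - (a \in H2 F1 F2 t y)%:R * eta2 mt a).

Lemma separated_off t y a : separated t y ->
  (a \notin active1 ->
    [/\ a \notin N1 F1 y, a \notin H12 F1 F2 t y & a \notin H1 F1 F2 t y]) /\
  (a \notin active2 ->
    [/\ a \notin N2 F2 y, a \notin H12 F1 F2 t y & a \notin H2 F1 F2 t y]).
Proof.
move=> [t0 h01 h10]; split; rewrite inE.
  case: (indexP a) (h10 a) => // _ _ /(_ isT) h _; rewrite !inE.
  by rewrite (gt_eqF h) (gt_eqF (lt_trans t0 h)).
case: (indexP a) (h01 a) => // _ _ /(_ isT) h _; rewrite !inE.
by rewrite (gt_eqF h) (gt_eqF (lt_trans t0 h)) !andbF.
Qed.

Lemma disj_mult_off t y mt : separated t y ->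
  (forall a, a \notin active1 -> disj_mult1 t y mt 0 a = 0) /\
  (forall a, a \notin active2 -> disj_mult2 t y mt 0 a = 0).
Proof.
move=> sep; split=> a aA; rewrite mxE.
  have [/(_ aA)[/negPf -> /negPf -> /negPf ->] _] := separated_off a sep.
  by rewrite !mul0r !subr0.
have [_ /(_ aA)[/negPf -> /negPf -> /negPf ->]] := separated_off a sep.
by rewrite !mul0r !subr0.
Qed.

Lemma disj_mult_inactive t y mt : separated t y ->
  row_mx (disj_mult1 t y mt) (disj_mult2 t y mt) *m inactive A = 0.
Proof.
move=> sep; have [off1 off2] := disj_mult_off mt sep.
apply/inactiveP => j; case: (split_ordP j) => a ->; rewrite joined_activeE.
  by rewrite row_mxEl; exact: off1.
by rewrite row_mxEr; exact: off2.
Qed.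

Let dG j x : differentiable (G j) x.
Proof. by case: (C2_joined active1 active2 j hF1 hF2) => -[]. Qed.

Let df x : differentiable f x. Proof. by case: hf => -[]. Qed.

Lemma disj_stationarity t y mt : separated t y ->
  (grad (disj_lagrangian f F1 F2 t y mt) y = 0) <->
  (grad f y = row_mx (disj_mult1 t y mt) (disj_mult2 t y mt) *m jac G y).
Proof.
move=> sep; have [off1 off2] := disj_mult_off mt sep.
have [c ->] := @disj_lagrangianE _ _ _ F1 F2 f t y mt active1 active2 off1 off2.
rewrite grad_lagr //; split=> [/eqP|->]; last by rewrite subrr.
by rewrite subr_eq0 => /eqP.
Qed.

Lemma disj_hess t y mt x : separated t y ->
  hess (disj_lagrangian f F1 F2 t y mt) x =
  hess (lagr f G (row_mx (disj_mult1 t y mt) (disj_mult2 t y mt)) 0) x.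
Proof.
move=> sep; have [off1 off2] := disj_mult_off mt sep.
have [c ->] := @disj_lagrangianE _ _ _ F1 F2 f t y mt active1 active2 off1 off2.
by rewrite (hess_lagr_cst hf (fun j => C2_joined _ _ j hF1 hF2)).
Qed.

(* The sign of the multiplier decides which of the two bounds F = 0 and F = t *)
(* is active.                                                                 *)
Lemma disj_active t y mt : separated t y -> disj_C_stationary_with f F1 F2 t y mt ->
    (forall j, j \in A -> let mu := row_mx (disj_mult1 t y mt) (disj_mult2 t y mt) in
       (l0 0 j < 0 -> mu 0 j < 0) /\ (0 < l0 0 j -> 0 < mu 0 j)) ->
  forall j, G j y = t * shift 0 j.
Proof.
move=> sep [_ _ pz [pe1 pe2] [pn1 pn2]] sgn j.
have [t0 _ _] := sep; have [nz1 nz2] := mult_neq0.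
have [jA|jA] := boolP (j \in A); last first.
  move/inactiveP: shift_inactive => -> //.
  by rewrite joined_inactive // mulr0.
have [sn sp] := sgn j jA; move: jA sn sp; rewrite [shift 0 j]mxE.
case: (split_ordP j) => a ->; rewrite joined_activeE => aA.
  rewrite !row_mxEl joinedl aA /coord_fun.
  have := nz1 a aA; case: (ltgtP (mult1 0 a) 0) => // _ _ sn sp.
    have := sn isT; rewrite mulr1 mxE.
    have [|_] := boolP (a \in H12 F1 F2 t y).
      by rewrite inE => /andP[/eqP].
    have [|_] := boolP (a \in H1 F1 F2 t y).
      by rewrite inE => /andP[/eqP].
    rewrite !mul0r !subr0; have [/pn1 h|_] := boolP (a \in N1 F1 y).
      by rewrite mul1r ltNge h.
    by rewrite mul0r ltxx.
  have := sp isT; rewrite mulr0 mxE.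
  have [|_] := boolP (a \in N1 F1 y); first by rewrite inE => /eqP.
  rewrite mul0r sub0r ltNge subr_le0 (@le_trans _ _ 0) //.
    rewrite oppr_le0; have [/pz[h _]|_] := boolP (a \in H12 _ _ _ _).
      by rewrite mul1r.
    by rewrite mul0r.
  have [/pe1 h|_] := boolP (a \in H1 _ _ _ _); first by rewrite mul1r.
  by rewrite mul0r.
rewrite !row_mxEr joinedr aA /coord_fun.
have := nz2 a aA; case: (ltgtP (mult2 0 a) 0) => // _ _ sn sp.
  have := sn isT; rewrite mulr1 mxE.
  have [|_] := boolP (a \in H12 F1 F2 t y).
    by rewrite inE => /andP[_ /eqP].
  have [|_] := boolP (a \in H2 F1 F2 t y).
    by rewrite inE => /andP[_ /eqP].
  rewrite !mul0r !subr0; have [/pn2 h|_] := boolP (a \in N2 F2 y).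
    by rewrite mul1r ltNge h.
  by rewrite mul0r ltxx.
have := sp isT; rewrite mulr0 mxE.
have [|_] := boolP (a \in N2 F2 y); first by rewrite inE => /eqP.
rewrite mul0r sub0r ltNge subr_le0 (@le_trans _ _ 0) //.
  rewrite oppr_le0; have [/pz[_ h]|_] := boolP (a \in H12 _ _ _ _).
    by rewrite mul1r.
  by rewrite mul0r.
have [/pe2 h|_] := boolP (a \in H2 _ _ _ _); first by rewrite mul1r.
by rewrite mul0r.
Qed.

(** * From a solution of the KKT system back to a C-stationary point of D(t) *)

Section shifted_point.
Variables (t : R) (x : 'rV[R]_n) (l : 'rV[R]_(k + k)).
Hypotheses (sep : separated t x) (Gx : forall j, G j x = t * shift 0 j).
Hypotheses (lN : l *m inactive A = 0) (st : grad f x = l *m jac G x).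
Hypothesis sgn : forall j, j \in A ->
  (l0 0 j < 0 -> l 0 j < 0) /\ (0 < l0 0 j -> 0 < l 0 j).

(** The same value fills several fields; for each component, the set N, H12 or H that contains the
    index decides which one is read, and the signed multiplier is then again l ([shifted_multE]). *)
Definition shifted_mult : disj_mult R k :=
  let l1 a := l 0 (lshift k a) in let l2 a := l 0 (rshift k a) in
  DisjMult (fun a => - l1 a) (fun a => - l2 a) (fun a => - l1 a)
    (fun a => - l2 a) l1 l2.

(** The possible positions of F1 at x, with the sign of its multiplier: at 0, at t together with F2,
    at t alone, or above t and inactive. *)
Variant shifted_spec1 a : bool -> bool -> bool -> Prop :=
| Shift1N of a \in active1 & 0 < l 0 (lshift k a) & F1 x 0 a = 0
    & 0 < mult1 0 a : shifted_spec1 a true false false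
| Shift1H12 of a \in a00 F1 F2 x0 & l 0 (lshift k a) < 0 & F1 x 0 a = t
    & F2 x 0 a = t & mult1 0 a < 0 : shifted_spec1 a false true false
| Shift1H1 of a \in a01 F1 F2 x0 & l 0 (lshift k a) < 0 & F1 x 0 a = t
    & t < F2 x 0 a & mult1 0 a < 0 : shifted_spec1 a false false true
| Shift1off of a \in a10 F1 F2 x0 & t < F1 x 0 a : shifted_spec1 a false false false.

Variant shifted_spec2 a : bool -> bool -> bool -> Prop :=
| Shift2N of a \in active2 & 0 < l 0 (rshift k a) & F2 x 0 a = 0
    & 0 < mult2 0 a : shifted_spec2 a true false false
| Shift2H12 of a \in a00 F1 F2 x0 & l 0 (rshift k a) < 0 & F1 x 0 a = t
    & F2 x 0 a = t & mult2 0 a < 0 : shifted_spec2 a false true false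
| Shift2H2 of a \in a10 F1 F2 x0 & l 0 (rshift k a) < 0 & F2 x 0 a = t
    & t < F1 x 0 a & mult2 0 a < 0 : shifted_spec2 a false false true
| Shift2off of a \in a01 F1 F2 x0 & t < F2 x 0 a : shifted_spec2 a false false false.

Let F1x a : a \in active1 -> F1 x 0 a = t * (mult1 0 a < 0)%R%:R.
Proof. by move=> aA; have := Gx (lshift k a); rewrite joinedl aA mxE row_mxEl. Qed.

Let F2x a : a \in active2 -> F2 x 0 a = t * (mult2 0 a < 0)%R%:R.
Proof. by move=> aA; have := Gx (rshift k a); rewrite joinedr aA mxE row_mxEr. Qed.

Let sgn1 a : a \in active1 -> (mult1 0 a < 0 -> l 0 (lshift k a) < 0) /\
  (0 < mult1 0 a -> 0 < l 0 (lshift k a)).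
Proof.
by move=> aA; have := @sgn (lshift k a); rewrite joined_activeE row_mxEl; apply.
Qed.

Let sgn2 a : a \in active2 -> (mult2 0 a < 0 -> l 0 (rshift k a) < 0) /\
  (0 < mult2 0 a -> 0 < l 0 (rshift k a)).
Proof.
by move=> aA; have := @sgn (rshift k a); rewrite joined_activeE row_mxEr; apply.
Qed.

Lemma shiftedP1 a : shifted_spec1 a (a \in N1 F1 x) (a \in H12 F1 F2 t x)
  (a \in H1 F1 F2 t x).
Proof.
have [t0 h01 h10] := sep; have [nz1 _] := mult_neq0.
have := F1x (a := a); have := F2x (a := a); have := sgn1 (a := a).
have := h01 a; have := h10 a; have := nz1 a; have := mult_a00 (a := a).
rewrite /N1 /H12 /H1 !inE.
have := @Shift1N a; have := @Shift1H12 a; have := @Shift1H1 a; have := @Shift1off a.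
rewrite !inE; have := indexP a; rewrite !inE.
case=> _ _ /= coff cH1 cH12 cN e nz p10 p01 sg f2 f1.
- have {}p01 := p01 isT; have {}f1 := f1 isT; have [sn sp] := sg isT.
  have := nz isT; case: (ltgtP (mult1 0 a) 0) f1 => // ms;
    rewrite ?mulr1 ?mulr0 => f1 _.
    by rewrite f1 (gt_eqF t0) eqxx p01 (gt_eqF p01) /=; apply: cH1 => //; exact: sn.
  by rewrite f1 eqxx (lt_eqF t0) /=; apply: cN => //; exact: sp.
- have {}p10 := p10 isT.
  by rewrite (gt_eqF p10) (gt_eqF (lt_trans t0 p10)) /=; exact: coff.
- have {}f1 := f1 isT; have [sn sp] := sg isT.
  (* At a biactive index the multiplier of F2 has the sign of that of F1, so F2 reaches t as
     well. *)
  have [e1 e2 e3] := e isT; have {}f2 := f2 isT.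
  have := nz isT; case: (ltgtP (mult1 0 a) 0) f1 => // ms;
    rewrite ?mulr1 ?mulr0 => f1 _.
    have ms2 : mult2 0 a < 0 by rewrite e2 -e3 -e1.
    rewrite ms2 mulr1 in f2.
    by rewrite f1 f2 (gt_eqF t0) eqxx ltxx /=; apply: cH12 => //; exact: sn.
  by rewrite f1 eqxx (lt_eqF t0) /=; apply: cN => //; exact: sp.
Qed.

Lemma shiftedP2 a : shifted_spec2 a (a \in N2 F2 x) (a \in H12 F1 F2 t x)
  (a \in H2 F1 F2 t x).
Proof.
have [t0 h01 h10] := sep; have [_ nz2] := mult_neq0.
have := F1x (a := a); have := F2x (a := a); have := sgn2 (a := a).
have := h01 a; have := h10 a; have := nz2 a; have := mult_a00 (a := a).
rewrite /N2 /H12 /H2 !inE.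
have := @Shift2N a; have := @Shift2H12 a; have := @Shift2H2 a; have := @Shift2off a.
rewrite !inE; have := indexP a; rewrite !inE.
case=> _ _ /= coff cH2 cH12 cN e nz p10 p01 sg f2 f1.
- have {}p01 := p01 isT.
  by rewrite (gt_eqF p01) (gt_eqF (lt_trans t0 p01)) !andbF /=; exact: coff.
- have {}p10 := p10 isT; have {}f2 := f2 isT; have [sn sp] := sg isT.
  have := nz isT; case: (ltgtP (mult2 0 a) 0) f2 => // ms;
    rewrite ?mulr1 ?mulr0 => f2 _.
    by rewrite f2 (gt_eqF t0) eqxx p10 (gt_eqF p10) /=; apply: cH2 => //; exact: sn.
  by rewrite f2 eqxx (lt_eqF t0) !andbF /=; apply: cN => //; exact: sp.
- have {}f1 := f1 isT; have [sn sp] := sg isT.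
  have [e1 e2 e3] := e isT; have {}f2 := f2 isT.
  have := nz isT; case: (ltgtP (mult2 0 a) 0) f2 => // ms;
    rewrite ?mulr1 ?mulr0 => f2 _.
    have ms1 : mult1 0 a < 0 by rewrite e1 e3 -e2.
    rewrite ms1 mulr1 in f1.
    by rewrite f1 f2 (gt_eqF t0) eqxx ltxx /=; apply: cH12 => //; exact: sn.
  by rewrite f2 eqxx (lt_eqF t0) !andbF /=; apply: cN => //; exact: sp.
Qed.

(** The bounds active at x belong to the components that vanish at x0, so DISJ-LICQ and the tangent
    space at x are those of the same family G. *)
Lemma shifted_active1 :
  (H12 F1 F2 t x :|: H1 F1 F2 t x :|: N1 F1 x)%SET = active1.
Proof.
apply/finset.setP => a; rewrite 2!finset.in_setU.
case: shiftedP1 => [->|h _ _ _ _|h _ _ _ _|h _] //;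
  rewrite finset.in_setU ?h ?orbT //.
by case: (indexP a) h.
Qed.

Lemma shifted_active2 :
  (H12 F1 F2 t x :|: H2 F1 F2 t x :|: N2 F2 x)%SET = active2.
Proof.
apply/finset.setP => a; rewrite 2!finset.in_setU.
case: shiftedP2 => [->|h _ _ _ _|h _ _ _ _|h _] //;
  rewrite finset.in_setU ?h ?orbT //.
by case: (indexP a) h.
Qed.

Lemma shifted_multE :
  row_mx (disj_mult1 t x shifted_mult) (disj_mult2 t x shifted_mult) = l.
Proof.
move/inactiveP: lN => l_off.
apply/rowP => j; case: (split_ordP j) => a ->; rewrite ?row_mxEl ?row_mxEr mxE.
  case: shiftedP1 => [_ _ _ _|_ _ _ _ _|_ _ _ _ _|h _] /=;
    rewrite ?mul1r ?mul0r ?subr0 ?sub0r ?opprK //.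
  by rewrite l_off // joined_activeE finset.in_setU; case: (indexP a) h.
case: shiftedP2 => [_ _ _ _|_ _ _ _ _|_ _ _ _ _|h _] /=;
  rewrite ?mul1r ?mul0r ?subr0 ?sub0r ?opprK //.
by rewrite l_off // joined_activeE finset.in_setU; case: (indexP a) h.
Qed.

Lemma shifted_hess :
  hess (disj_lagrangian f F1 F2 t x shifted_mult) x = hess (lagr f G l 0) x.
Proof.
etransitivity; first exact: disj_hess.
by congr (hess (lagr f G _ 0) x); exact: shifted_multE.
Qed.

(** Only one component per index has to be at most t: F1 for indices in [a01] and [a00], F2 for
    those in [a10]. *)
Lemma shifted_feasible : disj_feasible F1 F2 t x.
Proof.
have [t0 _ _] := sep.
have le1 a : a \notin a10 F1 F2 x0 -> F1 x 0 a <= t.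
  by case: (shiftedP1 a) => [_ _ -> _|_ _ -> _ _|_ _ -> _ _|-> //] _; rewrite // ltW.
have le2 a : a \notin a01 F1 F2 x0 -> F2 x 0 a <= t.
  by case: (shiftedP2 a) => [_ _ -> _|_ _ _ -> _|_ _ -> _ _|-> //] _; rewrite // ltW.
move=> a; split.
- rewrite le_max !subr_ge0; have := le1 a; have := le2 a.
  case: (indexP a) => _ _ h2 h1;
    by [rewrite (h1 isT)|rewrite (h2 isT) orbT|rewrite (h1 isT)].
- by case: (shiftedP1 a) => [_ _ -> _|_ _ -> _ _|_ _ -> _ _|_ /ltW] //;
    [exact: ltW|exact: ltW|apply: le_trans; exact: ltW].
- by case: (shiftedP2 a) => [_ _ -> _|_ _ _ -> _|_ _ -> _ _|_ /ltW] //;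
    [exact: ltW|exact: ltW|apply: le_trans; exact: ltW].
Qed.

Lemma shifted_ND2 : disj_ND2 F1 F2 t x shifted_mult.
Proof.
split=> a.
- move=> h; split; rewrite /= oppr_gt0.
    by case: shiftedP1 h.
  by case: shiftedP2 h.
- by rewrite /= oppr_gt0; case: shiftedP1.
- by rewrite /= oppr_gt0; case: shiftedP2.
- by case: shiftedP1.
- by case: shiftedP2.
Qed.

Lemma shifted_C_stationary : disj_C_stationary_with f F1 F2 t x shifted_mult.
Proof.
have [pz pe1 pe2 pn1 pn2] := shifted_ND2; split.
- exact: shifted_feasible.
- by apply/disj_stationarity; rewrite // shifted_multE.
- by move=> a /pz[/ltW ? /ltW ?].
- by split=> a => [/pe1|/pe2]; exact: ltW.
- by split=> a => [/pn1|/pn2]; exact: ltW.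
Qed.

(** An index is in [H12] exactly when it is biactive at x0 with both multipliers negative, and there
    zeta1 and zeta2 are positive. *)
Lemma shifted_BI : disj_BI F1 F2 t x shifted_mult = mpcc_BI F1 F2 x0 m.
Proof.
congr #|pred_of_set _|; apply/finset.setP => a.
rewrite finset.in_set [RHS]finset.in_set /= !oppr_eq0.
case: shiftedP1 => [aA _ _ pos|h l1 _ _ neg|h _ _ _ _|h _] /=.
- have := mult_a00 (a := a); case: (a \in a00 _ _ _) => // /(_ isT)[e _ _].
  by rewrite -e ltNge (ltW pos).
- have := shiftedP2 a; have [e1 e2 e3] := mult_a00 h.
  have r1 : rho1 m a < 0 by rewrite -e1.
  have r2 : rho2 m a < 0 by rewrite -e3.
  rewrite h r1 r2 (lt_eqF l1) /=; case=> [_ l2 _ _|_ l2 _ _ _|_ l2 _ _ _|h' _].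
  + by rewrite (gt_eqF l2).
  + by rewrite (lt_eqF l2).
  + by rewrite (lt_eqF l2).
  + by case: (indexP a) h h'.
- by case: (indexP a) h.
- by case: (indexP a) h.
Qed.

End shifted_point.

Let CG j : C2 (G j). Proof. exact: C2_joined. Qed.

Let mpccE : mpcc_lagrangian f F1 F2 x0 m = lagr f G l0 0.
Proof. exact: mpcc_lagrangianE. Qed.

Lemma sign_stable (a b : R) : `|b - a| < `|a| ->
  (a < 0 -> b < 0) /\ (0 < a -> 0 < b).
Proof.
move=> ba; split=> a0; move: ba.
  by rewrite (ltr0_norm a0) ltr_distl => /andP[_]; rewrite subrr.
by rewrite (gtr0_norm a0) ltr_distl subrr => /andP[].
Qed.

Lemma near_sign : exists2 d : R, 0 < d & forall mu : 'rV[R]_(k + k),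
  `|mu - l0| < d -> forall j, j \in A ->
  (l0 0 j < 0 -> mu 0 j < 0) /\ (0 < l0 0 j -> 0 < mu 0 j).
Proof.
have [nz1 nz2] := mult_neq0.
have nz j : j \in A -> l0 0 j != 0.
  case: (split_ordP j) => a ->; rewrite joined_activeE ?row_mxEl ?row_mxEr.
    exact: nz1.
  exact: nz2.
exists (\big[Num.min/1]_(j in A) `|l0 0 j|) => [|mu mul j jA].
  by elim/big_ind: _ => // [x y x1 y1|j jA];
    [rewrite lt_min x1 y1|rewrite normr_gt0 nz].
apply: sign_stable; rewrite -oppmxE -addmxE.
apply: le_lt_trans (mx_entry_norm_le _ _ _) (lt_le_trans mul _).
exact: bigmin_le_cond.
Qed.

(** Existence: the solution from [kkt_path] with right-hand side t times [shift], equipped with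
    [shifted_mult]. Uniqueness: [disj_active] brings every nearby C-stationary point back to the
    same system. *)
Lemma disj_path : exists2 d, 0 < d & forall e, 0 < e < d -> \forall t \near 0^'+,
  exists xt, [/\ `|xt - x0| < e,
    exists mt, [/\ disj_nondegenerate_with f F1 F2 t xt mt,
      disj_QI f F1 F2 t xt mt = mpcc_QI f F1 F2 x0 m &
      disj_BI F1 F2 t xt mt = mpcc_BI F1 F2 x0 m] &
    forall y, `|y - x0| < e -> disj_C_stationary f F1 F2 t y -> y = xt].
Proof.
have [[feas st _] lic _ nd3] := hnd.
have feas0 j : G j x0 = 0.
  case: (split_ordP j) => a ->; rewrite ?joinedl ?joinedr finset.in_setU.
    by case: (indexP a).
  by case: (indexP a).
have stat0 : grad f x0 = l0 *m jac G x0.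
  move: st; rewrite mpccE grad_lagr // => /eqP; rewrite subr_eq0.
  by move/eqP.
have ind0 : indep G A x0 by apply/licqP.
have kB : (row_base (mpcc_tangent F1 F2 x0) :=: kermx (jac G x0)^T)%MS.
  exact: eqmx_trans (eq_row_base _) (tangentE _ _ _ _ _).
move: nd3; rewrite /mpcc_ND3 /mpcc_restricted_hess mpccE => nd3.
have GA := @joined_inactive _ _ _ F1 F2 active1 active2.
have [d d0 path] := kkt_path hf CG GA feas0 mult_inactive stat0 ind0
  (row_base_free _) kB nd3.
have [ds ds0 sign] := near_sign.
have [d1 d10 mul] := (nbhs_rowP _ _).1
  (near_multipliers hf CG GA mult_inactive stat0 ind0 ds0).
have [c c0 /nbhs_rowP[d2 d20 sepP]] := near_separated.
(* d serves [kkt_path], d1 the closeness of multipliers, d2 the separation, and ds the signs. *)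
exists (Num.min (Num.min d d1) (Num.min d2 ds)) => [|e].
  by rewrite !lt_min d0 d10 d20 ds0.
rewrite !lt_min => /andP[e0 /andP[/andP[ed ed1] /andP[ed2 eds]]].
have ede : 0 < e < d by rewrite e0.
have tc : \forall t \near 0^'+, 0 < t < c.
  near=> t; apply/andP; split; near: t; first exact: nbhs_right_gt.
  exact: nbhs_right_lt.
move: tc (path e ede shift shift_inactive); apply: filterS2 => t tc.
move=> [x [l [[xe le lN] [stx Gx] indx idx uniq_x]]].
have sep : separated t x by apply: sepP tc; exact: lt_trans ed2.
have sgnl := sign l (lt_trans le eds).
exists x; split=> //.
  exists (shifted_mult l).
  have A1 := shifted_active1 sep Gx sgnl; have A2 := shifted_active2 sep Gx sgnl.
  have kT : (disj_tangent F1 F2 t x :=: kermx (jac G x)^T)%MS.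
    by rewrite /disj_tangent A1 A2; exact: tangentE.
  have HE := shifted_hess sep Gx lN sgnl.
  have [unit_x QI_x] := idx _ kT; split.
  - split; first exact: shifted_C_stationary.
    + by rewrite /disj_licq A1 A2; apply/licqP.
    + exact: shifted_ND2.
    + by rewrite /disj_ND3 /disj_restricted_hess HE.
  - by rewrite /disj_QI /mpcc_QI /disj_restricted_hess /mpcc_restricted_hess HE mpccE.
  - exact: shifted_BI.
move=> y ye [mt hmt].
have sepy : separated t y by apply: sepP tc; exact: lt_trans ed2.
have muN := disj_mult_inactive mt sepy.
have sty : grad f y = row_mx (disj_mult1 t y mt) (disj_mult2 t y mt) *m jac G y.
  by apply/disj_stationarity => //; case: hmt.
(* The multipliers mt are arbitrary, yet LICQ puts their signed version within ds of [l0], which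
   fixes their signs. *)
apply: (uniq_x y _ ye muN sty); apply: (disj_active sepy hmt); apply: sign.
by apply: (mul y) => //; exact: lt_trans ed1.
Unshelve. all: by end_near. Qed.

End regularization.

Theorem theorem4 (R : realType) (n k : nat) (f : 'rV[R]_n -> R)
    (F1 F2 : 'rV[R]_n -> 'rV[R]_k)
    (hf : C2 f) (hF1 : vC2 F1) (hF2 : vC2 F2)
    (xbar : 'rV[R]_n) (m : mpcc_mult R k)
    (hnd : mpcc_nondegenerate_with f F1 F2 xbar m)
    (hnd4 : mpcc_ND4 F1 F2 xbar m) :
  \forall e \near 0^'+, \forall t \near 0^'+,
    exists xt : 'rV[R]_n,
      [/\ ball xbar e xt,
          exists mt : disj_mult R k,
            [/\ disj_nondegenerate_with f F1 F2 t xt mt,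
                disj_QI f F1 F2 t xt mt = mpcc_QI f F1 F2 xbar m,
                disj_BI F1 F2 t xt mt = mpcc_BI F1 F2 xbar m
              & disj_CI f F1 F2 t xt mt = mpcc_CI f F1 F2 xbar m]
        & forall y : 'rV[R]_n, ball xbar e y ->
            disj_C_stationary f F1 F2 t y -> y = xt].
Proof.
have [d d0 path] := disj_path hf hF1 hF2 hnd hnd4.
have : \forall e \near 0^'+, 0 < e < d.
  near=> e; apply/andP; split; near: e; first exact: nbhs_right_gt.
  exact: nbhs_right_lt.
apply: filterS => e ed; move: (path e ed); apply: filterS => t.
case=> [x [xe [mt [nd qi bi]] uniq_x]]; exists x; split.
- by rewrite -ball_normE /= distrC.
- exists mt; split; [exact: nd|exact: qi|exact: bi|].
  exact: (f_equal2 addn qi bi).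
- by move=> y; rewrite -ball_normE /= distrC => /uniq_x.
Unshelve. all: by end_near. Qed.
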